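(* Let $2\leqslant n\in\mathbb{N}^+$, $2\leqslant b\in\mathbb{N}^+$ and $\tau\geqslant n-1$ (real). Then: (1) every element of $\widetilde{\mathcal{L}^2_{\tau+1,b}}(\mathbb{T}^n)$ possesses classical derivatives up to order $[\tau-n/2]+1$; (2) there exist elements $f\in\widetilde{\mathcal{L}^2_{\tau+1,b}}(\mathbb{T}^n)$ that admit weak derivatives of every order $m$ from $[\tau-n/2]+2$ to $[\tau]+1$ and whose weak derivatives $D^mf$ of each of these orders are unbounded (not essentially bounded on $\mathbb{T}^n$); (3) there exist elements of $\widetilde{\mathcal{L}^2_{\tau+1,b}}(\mathbb{T}^n)$ that do not admit weak derivatives of order $[\tau]+2$.
   Context: $[x]$ denotes the integral part of a real number $x$. $\mathbb{T}^n:=\mathbb{R}^n/2\pi\mathbb{Z}^n$. Functions are real mappings $f:\mathbb{T}^n\to\mathbb{R}^n$ with Fourier expansion $f(x)=\sum_{k\in\mathbb{Z}^n} f_k e^{\mathrm{i}\langle k,x\rangle}$, where $\langle k,x\rangle=\sum_{j=1}^n k_jx_j$ and $f_k=\int_{\mathbb{T}^n} f(x)e^{-\mathrm{i}\langle k,x\rangle}\,dx$ (the measure being normalized so that the expansion holds); functions are identified when equal almost everywhere. For $k\in\mathbb{Z}^n$, $|k|:=\sum_{j=1}^n|k_j|$. Define $$\widetilde{\mathcal{L}^2_{\tau+1,b}}(\mathbb{T}^n):=\Big\{f:\ \sum_{\nu=0}^\infty\Big(\sum_{b^{\nu-1}<|k|\leqslant b^\nu}|f_k|^2|k|^{2\tau+2}\Big)^{1/2}<+\infty\Big\}.$$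 Classical derivatives up to order $\ell$ means membership in $C^\ell(\mathbb{T}^n)$. The word ''weak'' is always in the $L^2$ sense on $\mathbb{T}^n$: $f$ admits weak derivatives of order $m$ if its distributional partial derivatives of order $m$ belong to $L^2(\mathbb{T}^n)$ (equivalently $\sum_k|f_k|^2|k|^{2m}<+\infty$). $D^mf$ denotes the collection of all weak partial derivatives of $f$ of order $m$. *)

(* Defs.v *)
From HB Require Import structures.
From mathcomp Require Import all_boot all_order all_algebra.
From mathcomp Require Import all_classical all_reals all_analysis.
From mathcomp Require Import complex.
Set Implicit Arguments.
Unset Strict Implicit.
Unset Printing Implicit Defensive.
Import Order.TTheory GRing.Theory Num.Theory.
Import numFieldNormedType.Exports.
Local Open Scope classical_set_scope.
Local Open Scope ring_scope.

(* A function on T^n = R^n / 2 pi Z^n is a 2 pi Z^n-periodic function of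
   x : 'rV[R]_n.  Topology and derivatives are those of 'rV[R]_n; the sigma
   algebra lives on n.-tuple (measurableTypeR R), the library having none on
   row vectors, and [tvec] goes from the latter to the former. *)

Definition torus_periodic (R : realType) (n : nat) (T : Type)
    (f : 'rV[R]_n -> T) : Prop :=
  forall (k : 'rV[int]_n) (x : 'rV[R]_n),
    f (x + (2 * pi) *: map_mx intr k) = f x.

Definition tvec (R : realType) (n : nat) (t : n.-tuple (measurableTypeR R)) :
    'rV[R]_n :=
  \row_j tnth t j.

Definition tcons (R : realType) (n : nat)
    (p : measurableTypeR R * n.-tuple (measurableTypeR R)) :
    n.+1.-tuple (measurableTypeR R) :=
  [the n.+1.-tuple (measurableTypeR R) of p.1 :: p.2].

Lemma measurable_tcons (R : realType) (n : nat) :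
  measurable_fun [set: measurableTypeR R * n.-tuple (measurableTypeR R)]
    (@tcons R n).
Proof. exact: measurable_cons. Qed.

HB.instance Definition _ (R : realType) (n : nat) :=
  isMeasurableFun.Build _ _ _ _ (@tcons R n) (@measurable_tcons R n).

Lemma twopi_gt0 (R : realType) : (0 : R) < 2 * pi.
Proof. by rewrite mulr_gt0 ?pi_gt0. Qed.

(* Normalized Lebesgue measure of the fundamental cube [0, 2 pi]^n: the n-fold
   product of the uniform probability on [0, 2 pi]. *)
Fixpoint torus_measure (R : realType) (n : nat) :
    probability (n.-tuple (measurableTypeR R)) R :=
  match n return probability (n.-tuple (measurableTypeR R)) R with
  | 0 => dirac ([tuple] : 0.-tuple (measurableTypeR R))
  | m.+1 =>
      distribution (uniform_prob (@twopi_gt0 R) \x torus_measure R m)%E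
        (@tcons R m)
  end.

Definition torus_integral (R : realType) (n : nat) (h : 'rV[R]_n -> R) : R :=
  (\int[torus_measure R n]_t h (tvec t))%R.

(* f : T^n -> R^n belongs to L^p(T^n). *)
Definition torus_Lp (R : realType) (n : nat) (p : \bar R)
    (f : 'rV[R]_n -> 'rV[R]_n) : Prop :=
  torus_periodic f /\
  forall j : 'I_n, (fun t => f (tvec t) 0 j) \in Lfun (torus_measure R n) p.

Definition torus_ae_eq (R : realType) (n : nat)
    (f g : 'rV[R]_n -> 'rV[R]_n) : Prop :=
  {ae torus_measure R n, forall t, f (tvec t) = g (tvec t)}.

Definition pairing (R : realType) (n : nat) (k : 'rV[int]_n) (x : 'rV[R]_n) :
    R :=
  \sum_j (k 0 j)%:~R * x 0 j.

Definition expi (R : realType) (theta : R) : R[i] :=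
  (cos theta +i* sin theta)%C.

Definition torus_cintegral (R : realType) (n : nat) (h : 'rV[R]_n -> R[i]) :
    R[i] :=
  (torus_integral (fun x => complex.Re (h x))
    +i* torus_integral (fun x => complex.Im (h x)))%C.

Definition fourier_coef (R : realType) (n : nat) (f : 'rV[R]_n -> 'rV[R]_n)
    (k : 'rV[int]_n) : 'rV[R[i]]_n :=
  \row_j torus_cintegral
    (fun x => ((f x 0 j)%:C)%C * expi (- pairing k x)).

Definition sqnormC (R : realType) (n : nat) (v : 'rV[R[i]]_n) : R :=
  \sum_j ComplexField.Normc.normc (v 0 j) ^+ 2.

Definition l1norm (n : nat) (k : 'rV[int]_n) : nat := (\sum_j `|k 0%R j|)%N.

Definition shell (R : realType) (n b nu : nat) : set 'rV[int]_n :=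
  [set k | b%:R ^ (nu%:Z - 1) < (l1norm k)%:R :> R /\ (l1norm k <= b ^ nu)%N].

(* Integrability is exactly what the Fourier coefficients require; membership
   then forces f to be in L^2. *)
Definition Ltilde (R : realType) (n : nat) (tau : R) (b : nat) :
    set ('rV[R]_n -> 'rV[R]_n) :=
  [set f | torus_Lp 1%E f /\
    (\sum_(0 <= nu <oo)
       (\esum_(k in @shell R n b nu)
          (sqnormC (fourier_coef f k)
             * (l1norm k)%:R `^ (2 * tau + 2))%:E) `^ (2^-1) < +oo)%E].

(* Iterated partial derivative: D_(i_1) ... D_(i_m) h for s = [:: i_1; ...; i_m]
   (junk when some directional derivative does not exist). *)
Definition partials (R : realType) (n : nat) (W : normedModType R)
    (s : seq 'I_n) (h : 'rV[R]_n -> W) : 'rV[R]_n -> W :=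
  foldr (fun (i : 'I_n) (g : 'rV[R]_n -> W) (x : 'rV[R]_n) =>
           'D_(delta_mx 0 i) g x) h s.

Definition torus_C (R : realType) (n : nat) (W : normedModType R) (l : nat)
    (h : 'rV[R]_n -> W) : Prop :=
  torus_periodic h /\
  forall s : seq 'I_n, (size s <= l)%N ->
    continuous (partials s h) /\
    ((size s < l)%N ->
       forall (i : 'I_n) (x : 'rV[R]_n),
         derivable (partials s h) x (delta_mx 0 i)).

Definition torus_Cinfty (R : realType) (n : nat) (W : normedModType R)
    (h : 'rV[R]_n -> W) : Prop :=
  forall l : nat, torus_C l h.

(* f is identified with its class modulo almost everywhere equality. *)
Definition has_classical_derivatives (R : realType) (n : nat) (l : nat)
    (f : 'rV[R]_n -> 'rV[R]_n) : Prop :=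
  exists g : 'rV[R]_n -> 'rV[R]_n, torus_C l g /\ torus_ae_eq f g.

(* g in L^2 is the distributional derivative D_(i_1) ... D_(i_m) f. *)
Definition is_weak_partial (R : realType) (n : nat) (s : seq 'I_n)
    (f g : 'rV[R]_n -> 'rV[R]_n) : Prop :=
  torus_Lp 2%:E g /\
  forall (phi : 'rV[R]_n -> R^o) (j : 'I_n), torus_Cinfty phi ->
    torus_integral (fun x => f x 0 j * partials s phi x) =
    (-1) ^+ size s * torus_integral (fun x => g x 0 j * phi x).

Definition admits_weak_derivatives (R : realType) (n : nat) (m : nat)
    (f : 'rV[R]_n -> 'rV[R]_n) : Prop :=
  forall s : seq 'I_n, size s = m -> exists g, is_weak_partial s f g.

(* The collection D^m f. *)
Definition weak_D (R : realType) (n : nat) (m : nat)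
    (f : 'rV[R]_n -> 'rV[R]_n) : set ('rV[R]_n -> 'rV[R]_n) :=
  [set g | exists2 s : seq 'I_n, size s = m & is_weak_partial s f g].

(* Essential boundedness of a collection: one bound for all its members. *)
Definition ess_bounded (R : realType) (n : nat)
    (G : set ('rV[R]_n -> 'rV[R]_n)) : Prop :=
  exists M : R, forall g, G g ->
    {ae torus_measure R n, forall t, `|g (tvec t)| <= M}.

(* Main.v *)
Require Import Defs.
From mathcomp Require Import all_boot all_order all_algebra.
From mathcomp Require Import all_classical all_reals all_analysis.
From mathcomp Require Import measurable_realfun.
From mathcomp Require Import ring lra zify.

(** Write a field on the torus as a real series of waves
    a_k cos<k,x> + b_k sin<k,x>, grouped into the shells b^(nu-1) < |k| <= b^nu.
    Two facts about the lattice sum of |k|^-n decide the three claims: it is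
    bounded over one shell, uniformly in the shell, and diverges over a cone.

    Classical derivatives.  The uniform bound over shells (shell_harmonic) holds
    because the shell has about b^(nu n) points, each of norm about b^nu.  By Cauchy-Schwarz the sum of |f_k| |k|^l
    over one shell is therefore at most a constant times
    (sum |f_k|^2 |k|^(2l+n))^(1/2), and 2l + n <= 2 tau + 2 exactly when
    l <= tau - n/2 + 1.  So membership in the space makes the l-th differentiated
    series absolutely summable (summable_fourier); the wave series is then of
    class C^l, by termwise differentiation (torus_C_wave_series), and it agrees
    with f almost everywhere because an integrable function all of whose Fourier
    coefficients vanish is almost everywhere zero (orthogonal_ae0).

    The two counterexamples are one field with two exponents p > n: every component
    is sum_k |k|^-p (cos<k,x> + sg(k_i) sin<k,x>), with a fixed coordinate i.  It lies
    in the space as soon as p > tau + 1 + n/2 (Ltilde_power_field) and has weak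
    derivatives of order m as soon as p > m + n/2 (power_weak_partial).  The signs
    make the cosine coefficients of its derivative D_i^m equal to |k_i|^m |k|^-p
    up to one common sign, whatever the parity of m (weak_partial_cosp).  On the
    cone |k| <= 2 k_i these are at least a multiple of |k|^(m-p), and the sum of
    |k|^-n over that cone diverges (harmonic_cone_unbounded).

    Unbounded derivatives.  A function bounded by M with nonnegative cosine
    coefficients has sum of coefficients at most 2^n M: integrate it against the
    Fejer kernel sum_(k,l) cos<k-l,x> over a box, which is nonnegative
    (sum_bounded_coef).  With p = n + m0, where m0 = [tau - n/2] + 2, the
    coefficients for m >= m0 dominate |k|^-n on the cone, so D_i^m f cannot be
    bounded.

    Missing derivatives.  With p = M0 + n/2, where M0 = [tau] + 2, the squares of
    the coefficients of D_i^M0 f dominate |k|^-n on the cone, which contradicts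
    Bessel's inequality (bessel_cosp). *)

Set Implicit Arguments.
Unset Strict Implicit.
Unset Printing Implicit Defensive.
Import Order.TTheory GRing.Theory Num.Theory.
Import numFieldNormedType.Exports.
Local Open Scope classical_set_scope.
Local Open Scope ring_scope.

(** * Integration over the torus *)
Section torus_integral_theory.
Context {R : realType}.
Implicit Types (n : nat).

(** The measure lives on tuples and functions on row vectors, so measurability and
integrability are those of the function transported along tvec. *)
Definition tmeas n (h : 'rV[R]_n -> R) : Prop :=
  measurable_fun [set: n.-tuple (measurableTypeR R)] (fun t => h (tvec t)).

Definition fbounded n (h : 'rV[R]_n -> R) : Prop :=
  exists M : R, forall x, `|h x| <= M.

Definition tint n (h : 'rV[R]_n -> R) : Prop :=
  (torus_measure R n).-integrable setT (fun t => (h (tvec t))%:E).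

Lemma tint_tmeas n (h : 'rV[R]_n -> R) : tint h -> tmeas h.
Proof. by move/measurable_int/measurable_EFinP. Qed.

Lemma le_tint n (f g : 'rV[R]_n -> R) :
  tmeas f -> tint g -> (forall x, `|f x| <= `|g x|) -> tint f.
Proof.
move=> mf ig fg; apply: le_integrable ig => //; first exact/measurable_EFinP.
by move=> t _ /=; rewrite lee_fin.
Qed.

Lemma tint_cst n c : tint (fun _ : 'rV[R]_n => c).
Proof. exact: (finite_measure_integrable_cst (torus_measure R n) c). Qed.

Lemma tint_fbounded n (h : 'rV[R]_n -> R) : tmeas h -> fbounded h -> tint h.
Proof.
move=> mh [M hM]; apply: (le_tint mh (tint_cst n M)) => x.
by rewrite (le_trans (hM x))// ler_norm.
Qed.

Lemma tmeas_cst n c : tmeas (fun _ : 'rV[R]_n => c).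
Proof. exact: measurable_cst. Qed.

Lemma tmeasD n (f g : 'rV[R]_n -> R) :
  tmeas f -> tmeas g -> tmeas (fun x => f x + g x).
Proof. by move=> *; exact: measurable_funD. Qed.

Lemma tmeasM n (f g : 'rV[R]_n -> R) :
  tmeas f -> tmeas g -> tmeas (fun x => f x * g x).
Proof. by move=> *; exact: measurable_funM. Qed.

Lemma tintD n (f g : 'rV[R]_n -> R) :
  tint f -> tint g -> tint (fun x => f x + g x).
Proof. by move=> fi gi; have := integrableD measurableT fi gi. Qed.

Lemma tintZ n c (f : 'rV[R]_n -> R) : tint f -> tint (fun x => c * f x).
Proof. by move=> fi; have := integrableZl measurableT c fi. Qed.

Lemma tintB n (f g : 'rV[R]_n -> R) :
  tint f -> tint g -> tint (fun x => f x - g x).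
Proof. by move=> fi gi; have := integrableB measurableT fi gi. Qed.

Lemma tintM n (f g : 'rV[R]_n -> R) :
  tint f -> tmeas g -> fbounded g -> tint (fun x => f x * g x).
Proof.
move=> fi mg [M gM]; apply: (@le_tint _ _ (fun x => M * f x)).
- by apply: tmeasM => //; exact: tint_tmeas.
- exact: tintZ.
- move=> x; rewrite !normrM mulrC ler_wpM2r// (le_trans (gM x))//.
  exact: ler_norm.
Qed.

Lemma tint_sum n I (s : seq I) (F : I -> 'rV[R]_n -> R) :
  (forall i, tint (F i)) -> tint (fun x => \sum_(i <- s) F i x).
Proof.
move=> Fi; elim: s => [|i s IH].
  by under eq_fun do rewrite big_nil; exact: tint_cst.
by under eq_fun do rewrite big_cons; exact: tintD.
Qed.

Lemma torus_integralD n (f g : 'rV[R]_n -> R) : tint f -> tint g ->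
  torus_integral (fun x => f x + g x) = torus_integral f + torus_integral g.
Proof. by move=> fi gi; rewrite /torus_integral RintegralD. Qed.

Lemma torus_integralB n (f g : 'rV[R]_n -> R) : tint f -> tint g ->
  torus_integral (fun x => f x - g x) = torus_integral f - torus_integral g.
Proof. by move=> fi gi; rewrite /torus_integral RintegralB. Qed.

Lemma torus_integralZ n c (f : 'rV[R]_n -> R) : tint f ->
  torus_integral (fun x => c * f x) = c * torus_integral f.
Proof. by move=> fi; rewrite /torus_integral RintegralZl. Qed.

Lemma torus_integral_cst n c : torus_integral (fun _ : 'rV[R]_n => c) = c.
Proof.
rewrite /torus_integral Rintegral_cst//.
rewrite [X in _ * fine X](_ : _ = 1%E) ?mulr1//; exact: probability_setT.
Qed.

Lemma torus_integral_sum n I (s : seq I) (F : I -> 'rV[R]_n -> R) :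
  (forall i, tint (F i)) ->
  torus_integral (fun x => \sum_(i <- s) F i x) =
  \sum_(i <- s) torus_integral (F i).
Proof.
move=> Fi; elim: s => [|i s IH].
  by under eq_fun do rewrite big_nil; rewrite big_nil torus_integral_cst.
under eq_fun do rewrite big_cons.
by rewrite torus_integralD ?big_cons ?IH//; exact: tint_sum.
Qed.

Lemma fbounded_cst n c : fbounded (fun _ : 'rV[R]_n => c).
Proof. by exists `|c|. Qed.

Lemma fboundedD n (f g : 'rV[R]_n -> R) :
  fbounded f -> fbounded g -> fbounded (fun x => f x + g x).
Proof.
move=> [M fM] [N gN]; exists (M + N) => x.
by rewrite (le_trans (ler_normD _ _))// lerD.
Qed.

Lemma fboundedM n (f g : 'rV[R]_n -> R) :
  fbounded f -> fbounded g -> fbounded (fun x => f x * g x).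
Proof.
by move=> [M fM] [N gN]; exists (M * N) => x; rewrite normrM ler_pM.
Qed.

(** The sigma-algebra of tuples is generated by the coordinates, not by a topology,
so measurability of a continuous function needs an approximation: rounding every
coordinate down to a multiple of 1/(N+1) makes the function countably valued on
measurable boxes, and continuity makes these step functions converge. *)
Lemma tmeas_continuous n (u : 'rV[R]_n -> R) : continuous u -> tmeas u.
Proof.
move=> cu.
pose g (N : nat) (x : 'rV[R]_n) : 'rV[R]_n :=
  \row_j ((Num.floor (N.+1%:R * x 0 j))%:~R / N.+1%:R).
apply: (measurable_fun_cvg (h := fun N t => u (g N (tvec t)))).
  move=> N _ B mB; rewrite setTI.
  pose fl (t : n.-tuple (measurableTypeR R)) : 'rV[int]_n :=
    \row_j Num.floor (N.+1%:R * tnth t j).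
  pose F (k : 'rV[int]_n) : set (n.-tuple (measurableTypeR R)) :=
    \bigcap_(j : 'I_n) ((fun t => tnth t j) @^-1`
      [set x | (k 0 j)%:~R <= N.+1%:R * x < (k 0 j + 1)%:~R]).
  rewrite (_ : _ @^-1` _ = \bigcup_(k in [set k : 'rV[int]_n |
      B (u (\row_j ((k 0 j)%:~R / N.+1%:R)))]) F k).
    rewrite bigcup_mkcond; apply: countable_bigcupT_measurable => [|k].
      exact: countableP.
    case: ifP => // _; apply: fin_bigcap_measurable => // j _.
    rewrite -[X in measurable X]setTI; apply: measurable_tnth => //.
    rewrite (_ : [set _ | _] = `[(k 0 j)%:~R / N.+1%:R, (k 0 j + 1)%:~R / N.+1%:R[%classic).
      exact: measurable_itv.
    apply/seteqP; split => x /=; rewrite in_itv/= ler_pdivrMr// ltr_pdivlMr//;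
     by rewrite mulrC.
  have flE t : g N (tvec t) = \row_j ((fl t 0 j)%:~R / N.+1%:R).
    by apply/rowP => j; rewrite !mxE.
  apply/seteqP; split => t /=.
    rewrite flE => Bt; exists (fl t) => //= j _ /=.
    by rewrite mxE Num.Theory.floor_itv// num_real.
  move=> [k Bk Fk]; rewrite (_ : g N (tvec t) = \row_j ((k 0 j)%:~R / N.+1%:R))//.
  rewrite flE; apply/rowP => j; rewrite !mxE; congr (_%:~R / _).
  exact/floor_def/(Fk j).
move=> t _; apply: (@cvg_comp _ _ _ (fun N => g N (tvec t)) u); last exact: cu.
apply/cvgrPdist_le => /= e e0.
pose ep := PosNum e0.
near=> N.
rewrite [leLHS]/Num.Def.normr/= mx_normrE (bigmax_le _ (ltW e0))//= => -[i j] _.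
rewrite !mxE/=; set x : R := tnth t j.
have N0 : 0 < N.+1%:R :> R by [].
apply: (@le_trans _ _ N.+1%:R^-1); last first.
  by apply/ltW; near: N; exact: (near_infty_natSinv_lt ep).
rewrite ler_norml; have /andP[h1 h2] := Num.Theory.floor_itv (N.+1%:R * x).
rewrite -/x in h1 h2 *; rewrite intrD in h2.
have : x - (Num.floor (N.+1%:R * x))%:~R / N.+1%:R =
  (N.+1%:R * x - (Num.floor (N.+1%:R * x))%:~R) / N.+1%:R.
  by field.
move=> ->; rewrite lerNl -mulNr !ler_pdivrMr// mulVf ?gt_eqF//.
by apply/andP; split; lra.
Unshelve. all: by end_near. Qed.

(** The row vector counterpart of tcons: r becomes coordinate 0. *)
Definition rcons0 n (r : R) (y : 'rV[R]_n) : 'rV[R]_n.+1 :=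
  \row_j oapp (y 0) r (unlift ord0 j).

Lemma tvec_tcons n r (t : n.-tuple (measurableTypeR R)) :
  tvec (tcons (r, t)) = rcons0 r (tvec t).
Proof.
apply/rowP => j; rewrite !mxE; case: unliftP => [i ->|->] /=; last by [].
by rewrite mxE tnthS.
Qed.

(** With the head coordinate outermost one can recurse on the tail; with it innermost one
can integrate it first.  Both orders serve below. *)
Lemma torus_integral_cons n (w : 'rV[R]_n.+1 -> R) : tmeas w -> fbounded w ->
  ((torus_integral w)%:E = \int[uniform_prob (@twopi_gt0 R)]_r
     \int[torus_measure R n]_t (w (rcons0 r (tvec t)))%:E)%E /\
  ((torus_integral w)%:E = \int[torus_measure R n]_t
     \int[uniform_prob (@twopi_gt0 R)]_r (w (rcons0 r (tvec t)))%:E)%E.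
Proof.
move=> mw bw.
have iw := tint_fbounded mw bw.
pose f (p : measurableTypeR R * n.-tuple (measurableTypeR R)) : \bar R :=
  (w (rcons0 p.1 (tvec p.2)))%:E.
have fE : f = (fun p => (w (tvec (tcons p)))%:E).
  by apply/funext => -[r t]; rewrite tvec_tcons.
have mf : measurable_fun setT f.
  rewrite fE; apply/measurable_EFinP.
  exact: (measurableT_comp mw (@measurable_tcons R n)).
pose P : probability _ R := (uniform_prob (@twopi_gt0 R) \x torus_measure R n)%E.
have fi : P.-integrable setT f.
  case: bw => M bw.
  apply: (@le_integrable _ _ _ P _ _ f (EFin \o cst M)) => //=.
    by move=> [r t] _; rewrite lee_fin (le_trans (bw _))// ler_norm.
  exact: (finite_measure_integrable_cst P M).
have E : ((torus_integral w)%:E = \int[P]_p f p)%E.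
  rewrite /torus_integral /Rintegral fineK; last exact: integrable_fin_num.
  rewrite [LHS]integral_distribution//=; [|exact/measurable_EFinP|].
    by rewrite fE.
  by rewrite fE in fi.
rewrite E; split; first by rewrite -integral12_prod_meas1.
by rewrite -integral21_prod_meas1.
Qed.

Definition upd n (i : 'I_n) (r : R) (x : 'rV[R]_n) : 'rV[R]_n :=
  \row_j if j == i then r else x 0 j.

Lemma tmeas_rcons0 n (w : 'rV[R]_n.+1 -> R) r :
  tmeas w -> tmeas (fun y => w (rcons0 r y)).
Proof.
move=> mw; rewrite /tmeas.
under eq_fun do rewrite -tvec_tcons.
apply: (measurableT_comp mw).
exact: (measurableT_comp (@measurable_tcons R n)).
Qed.

(** By Fubini, an integral vanishes once integration over the single coordinate i
already gives 0.  The induction on the dimension moves i to the front. *)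
Lemma torus_integral_section0 n (i : 'I_n) (w : 'rV[R]_n -> R) :
  tmeas w -> fbounded w ->
  (forall x, (\int[uniform_prob (@twopi_gt0 R)]_r (w (upd i r x))%:E = 0)%E) ->
  torus_integral w = 0.
Proof.
elim: n i w => [[]//|n IH] i w mw bw w0.
have [E1 E2] := torus_integral_cons mw bw.
apply: EFin_inj; case: (unliftP ord0 i) => [j ij|i0].
- rewrite E1 integral0_eq// => r _.
  have mwr : tmeas (fun y => w (rcons0 r y)) by exact: tmeas_rcons0.
  have bwr : fbounded (fun y => w (rcons0 r y)).
    by case: bw => M bw; exists M => y; exact: bw.
  have iwr := tint_fbounded mwr bwr.
  rewrite -[LHS]fineK; last exact: integrable_fin_num.
  congr _%:E; apply: (IH j _ mwr bwr) => x.
  rewrite -[RHS](w0 (rcons0 r x)); apply: eq_integral => r' _.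
  congr (w _)%:E; apply/rowP => k; rewrite !mxE.
  case: (unliftP ord0 k) => [k' ->|->] /=.
    by rewrite ij (inj_eq lift_inj) mxE; case: ifP.
  by rewrite ij.
- rewrite E2 integral0_eq// => t _.
  rewrite -[RHS](w0 (rcons0 0 (tvec t))); apply: eq_integral => r _.
  congr (w _)%:E; apply/rowP => k; rewrite !mxE.
  by case: (unliftP ord0 k) => [k' ->|->] /=; rewrite i0 ?eqxx.
Qed.

(** Fundamental theorem of calculus on [0, 2 pi], with equal values of the primitive at
the two ends. *)
Lemma uniform_integral_deriv0 (u w : R -> R) (M : R) :
  continuous w -> (forall r, is_derive r (1 : R) u (w r)) -> (forall r, `|w r| <= M) ->
  u (2 * pi) = u 0 ->
  (\int[uniform_prob (@twopi_gt0 R)]_r (w r)%:E = 0)%E.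
Proof.
move=> cw du bw u2.
pose U : probability (measurableTypeR R) R := uniform_prob (@twopi_gt0 R).
rewrite -/U.
have mw : measurable_fun setT w by exact: continuous_measurable_fun.
have iw : U.-integrable setT (fun r => (w r)%:E).
  apply: (@le_integrable _ _ _ U _ _ _ (EFin \o cst M)) => //=.
  - exact/measurable_EFinP.
  - by move=> r _; rewrite lee_fin (le_trans (bw r))// ler_norm.
  - exact: (finite_measure_integrable_cst U M).
(* The formula for the uniform law applies to nonnegative integrands: hence the shift by M. *)
have E : (\int[U]_r (w r + M)%:E = M%:E)%E.
  rewrite integral_uniform; first last.
  - by move=> r; rewrite lee_fin; have := bw r; rewrite ler_norml => /andP[]; lra.
  - apply/measurable_EFinP; exact: measurable_funD.
  rewrite (@continuous_FTC2 _ _ (fun r => u r + M * r) _ _ (twopi_gt0 R)).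
  - rewrite u2 subr0 mulr0 -EFinB -EFinM; congr _%:E.
    have := twopi_gt0 R; set p := 2 * pi => p0; field; lra.
  - apply: continuous_subspaceT => r; apply: cvgD; [exact: cw|exact: cvg_cst].
  - have cF : continuous (fun r => u r + M * r).
      move=> r; apply: cvgD.
        apply: differentiable_continuous; apply/derivable1_diffP.
        by have [] := du r.
      apply: cvgM; [exact: cvg_cst|exact: cvg_id].
    have dF r : derivable (fun r => u r + M * r) r 1.
      apply: derivableD; first by have [] := du r.
      exact: derivableM.
    split => //; [exact: cvg_at_right_filter (cF 0)|exact: cvg_at_left_filter (cF _)].
  - move=> r _; rewrite derive1E deriveD; [|by have [] := du r|exact: derivableM].
    rewrite derive_val; congr (_ + _).
    by rewrite deriveM// derive_cst derive_id scaler0 addr0 /GRing.scale/= mulr1.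
have : (\int[U]_r (w r + M)%:E = \int[U]_r (w r)%:E + M%:E)%E.
  under eq_integral do rewrite EFinD.
  rewrite integralD//; last exact: finite_measure_integrable_cst.
  by rewrite integral_cst// [X in (_ * X)%E](_ : _ = 1%E) ?mule1//; exact: probability_setT.
rewrite E.
have := integrable_fin_num measurableT iw; case: (\int[U]_r _)%E => //= a _.
by rewrite -EFinD => -[] h; congr _%:E; lra.
Qed.

(** Every value is attained on the compact cube [0, 2 pi]^n. *)
Lemma fbounded_periodic n (u : 'rV[R]_n -> R) :
  continuous u -> torus_periodic u -> fbounded u.
Proof.
move=> cu pu.
pose K := [set v : 'rV[R]_n | forall i, `[0, 2 * pi]%classic (v ord0 i)].
have cK : compact K
  by apply: (@rV_compact R n (fun _ => `[0, 2 * pi]%classic)) => _; exact: segment_compact.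
have : compact (u @` K).
  by apply: continuous_compact => //; exact: continuous_subspaceT.
move/compact_bounded => [M [_ hM]]; exists (`|M| + 1) => x.
have p0 := twopi_gt0 R.
pose k : 'rV[int]_n := \row_j - Num.floor (x 0 j / (2 * pi)).
rewrite -(pu k x); apply: (hM (`|M| + 1)).
  by rewrite (le_lt_trans (ler_norm M))// ltrDl.
eexists; last reflexivity; move=> i /=; rewrite in_itv/= !mxE mulrNz.
have /andP[] := Num.Theory.floor_itv (x 0 i / (2 * pi)).
move: p0; set p := 2 * pi; move: p => p p0.
rewrite ler_pdivlMr// ltr_pdivrMr// intrD mulrDl mul1r mulrN.
by rewrite [_%:~R * p]mulrC => h1 h2; apply/andP; split; lra.
Qed.

Lemma torus_periodic_derive n (u : 'rV[R]_n -> R^o) v :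
  torus_periodic u -> torus_periodic ('D_v u).
Proof.
move=> pu k x; rewrite /derive.
rewrite (_ : (fun h : R => h^-1 *: _) =
             (fun h : R => h^-1 *: (u (h *: v + x) - u x)))//.
by apply/funext => h /=; rewrite addrA !pu.
Qed.

Lemma upd_add n (i : 'I_n) (r s : R) (x : 'rV[R]_n) :
  upd i (s + r) x = s *: delta_mx 0 i + upd i r x.
Proof.
apply/rowP => j; rewrite !mxE !eqxx /=.
by case: eqP => _ /=; rewrite ?mulr1 ?mulr0 ?add0r.
Qed.

Lemma continuous_upd n (i : 'I_n) (x : 'rV[R]_n) :
  continuous (fun r => upd i r x).
Proof.
move=> r; rewrite (_ : (fun r => _) = (fun r => r *: delta_mx 0 i + upd i 0 x)).
  by apply: cvgD; [apply: cvgZr_tmp; exact: cvg_id|exact: cvg_cst].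
by apply/funext => s; rewrite -upd_add addr0.
Qed.

(** The fundamental theorem of calculus along coordinate i, where periodicity cancels
the boundary terms.  All orthogonality relations and all integrations by parts
below come from this. *)
Lemma torus_integral_derive0 n (i : 'I_n) (u : 'rV[R]_n -> R^o) :
  torus_periodic u -> (forall x, derivable u x (delta_mx 0 i)) ->
  continuous ('D_(delta_mx 0 i) u) ->
  torus_integral ('D_(delta_mx 0 i) u) = 0.
Proof.
move=> pu du cu.
have [M bM] := fbounded_periodic cu (torus_periodic_derive _ pu).
apply: (torus_integral_section0 (i := i)).
- exact: tmeas_continuous.
- by exists M.
move=> x.
have quo r : (fun h : R => h^-1 *: (u (upd i (h *: (1 : R) + r) x) - u (upd i r x))) =
   (fun h => h^-1 *: (u (h *: delta_mx 0 i + upd i r x) - u (upd i r x))).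
  by apply/funext => h; rewrite /GRing.scale /= mulr1 upd_add.
apply: (@uniform_integral_deriv0 (fun r => u (upd i r x)) _ M).
- move=> r; apply: (@continuous_comp R 'rV[R]_n R (fun r => upd i r x) ('D_(delta_mx 0 i) u)).
    exact: continuous_upd.
  exact: cu.
- move=> r; split; first by rewrite /derivable /= quo; exact: du.
  by rewrite /derive /= quo.
- by move=> r; exact: bM.
- rewrite (_ : upd i (2 * pi) x = upd i 0 x + (2 * pi) *: map_mx intr (delta_mx 0 i)).
    exact: pu.
  rewrite -[2 * pi]addr0 upd_add addr0 addrC; congr (_ + _ *: _).
  by apply/rowP => j; rewrite !mxE eqxx /=; case: (j == i).
Qed.

(** The open cube has full measure, so that formulas valid only for coordinates in
]0, 2 pi[ may be used under the integral. *)
Definition torus_cube n : set (n.-tuple (measurableTypeR R)) :=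
  \bigcap_(j : 'I_n) ((fun t => tnth t j) @^-1` `]0, 2 * pi[%classic).

Lemma measurable_torus_cube n : measurable (@torus_cube n).
Proof.
apply: fin_bigcap_measurable => // j _.
by rewrite -[X in measurable X]setTI; apply: measurable_tnth.
Qed.

Lemma torus_measure_cube n : torus_measure R n (@torus_cube n) = 1%E.
Proof.
elim: n => [|n IH].
  rewrite [LHS]diracE mem_set//.
  by move=> [[]].
rewrite /= /distribution /pushforward.
rewrite (_ : _ @^-1` _ = `]0, 2 * pi[%classic `*` @torus_cube n); last first.
  apply/seteqP; split => [[r t] h|[r t] [/= h1 h2] j _].
    split; first exact: (h ord0).
    by move=> j _; have := h (lift ord0 j) I; rewrite /= tnthS.
  by case: (unliftP ord0 j) => [k ->|->] //=; rewrite tnthS; exact: h2.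
transitivity (uniform_prob (@twopi_gt0 R) (`]0, 2 * pi[%classic)%R * torus_measure R n (@torus_cube n))%E.
  by apply: product_measure1E => //; exact: measurable_torus_cube.
rewrite IH mule1.
rewrite /uniform_prob integral_uniform_pdf.
rewrite (_ : _ `&` _ = `]0, 2 * pi[%classic); last first.
  apply/seteqP; split => [x [] //|x h]; split => //.
  by move: h => /=; rewrite !in_itv/= => /andP[/ltW -> /ltW ->].
rewrite (eq_integral (fun=> (2 * pi - 0)^-1%:E)); last first.
  move=> x; rewrite inE/= in_itv/= => /andP[/ltW h1 /ltW h2].
  by rewrite /uniform_pdf h1 h2.
rewrite integral_cst//= lebesgue_measure_itv/= lte_fin twopi_gt0.
by rewrite -EFinD -EFinM mulVf// gt_eqF// subr0 twopi_gt0.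
Qed.

Lemma ae_torus_coord n : {ae torus_measure R n,
  forall t, forall j, 0 < tnth t j < 2 * pi}.
Proof.
have mC := @measurable_torus_cube n.
exists (~` @torus_cube n); split; first exact/measurableC.
  by rewrite [LHS](probability_setC (torus_measure R n) mC) torus_measure_cube subee.
move=> t /= ht cubet; apply: ht => j; have := cubet j I.
by rewrite /= in_itv.
Qed.

(** * Waves and their orthogonality *)
Lemma pairingDl n (k l : 'rV[int]_n) (x : 'rV[R]_n) :
  pairing (k + l) x = pairing k x + pairing l x.
Proof.
rewrite /pairing -big_split; apply: eq_bigr => j _.
by rewrite mxE intrD mulrDl.
Qed.

Lemma pairingNl n (k : 'rV[int]_n) (x : 'rV[R]_n) :
  pairing (- k) x = - pairing k x.
Proof.
rewrite /pairing -sumrN; apply: eq_bigr => j _.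
by rewrite mxE mulrNz mulNr.
Qed.

Lemma pairing0l n (x : 'rV[R]_n) : pairing 0 x = 0.
Proof. by rewrite /pairing big1// => j _; rewrite mxE mul0r. Qed.

Lemma pairingDr n (k : 'rV[int]_n) (x y : 'rV[R]_n) :
  pairing k (x + y) = pairing k x + pairing k y.
Proof.
by rewrite /pairing -big_split; apply: eq_bigr => j _; rewrite mxE mulrDr.
Qed.

Lemma pairing_dir n (k : 'rV[int]_n) (i : 'I_n) (h : R) :
  pairing k (h *: delta_mx 0 i) = (k 0 i)%:~R * h.
Proof.
rewrite /pairing (bigD1 i)//= !mxE !eqxx mulr1 big1 ?addr0// => j ji.
by rewrite !mxE (negbTE ji) andbF mulr0 mulr0.
Qed.

Lemma pairing_delta n (i : 'I_n) (x : 'rV[R]_n) :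
  pairing (delta_mx 0 i) x = x 0 i.
Proof.
rewrite /pairing (bigD1 i)//= !mxE !eqxx mul1r big1 ?addr0// => j ji.
by rewrite !mxE (negbTE ji) andbF mul0r.
Qed.

Lemma pairing_period n (k l : 'rV[int]_n) :
  pairing k ((2 * pi) *: map_mx intr l : 'rV[R]_n) =
  (\sum_j k 0 j * l 0 j)%:~R * (2 * pi).
Proof.
rewrite /pairing rmorph_sum/= mulr_suml; apply: eq_bigr => j _.
by rewrite !mxE intrM mulrACA [RHS]mulrC mulrA; ring.
Qed.

Lemma cos_period (x : R) (m : int) : cos (x + m%:~R * (2 * pi)) = cos x.
Proof.
case: (intP m) => [|p|p]; first by rewrite mul0r addr0.
- by rewrite -[RHS](periodicn (@cosD2pi R) p.+1); congr cos; rewrite -mulr_natl -mulr_natr; ring.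
- rewrite -[LHS](periodicn (@cosD2pi R) p.+1); congr cos; rewrite -mulr_natl -mulr_natr mulrNz; ring.
Qed.

Lemma sin_period (x : R) (m : int) : sin (x + m%:~R * (2 * pi)) = sin x.
Proof.
case: (intP m) => [|p|p]; first by rewrite mul0r addr0.
- by rewrite -[RHS](periodicn (@sinD2pi R) p.+1); congr sin; rewrite -mulr_natl -mulr_natr; ring.
- rewrite -[LHS](periodicn (@sinD2pi R) p.+1); congr sin; rewrite -mulr_natl -mulr_natr mulrNz; ring.
Qed.

Definition cosp n (k : 'rV[int]_n) (x : 'rV[R]_n) : R := cos (pairing k x).
Definition sinp n (k : 'rV[int]_n) (x : 'rV[R]_n) : R := sin (pairing k x).

Lemma periodic_cosp n (k : 'rV[int]_n) : torus_periodic (@cosp n k).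
Proof. by move=> l x; rewrite /cosp pairingDr pairing_period cos_period. Qed.

Lemma periodic_sinp n (k : 'rV[int]_n) : torus_periodic (@sinp n k).
Proof. by move=> l x; rewrite /sinp pairingDr pairing_period sin_period. Qed.

Lemma cvgr_sum T (F : set_system T) (FF : Filter F) I (s : seq I)
    (f : I -> T -> R) (a : I -> R) :
  (forall i, f i x @[x --> F] --> a i) ->
  \sum_(i <- s) f i x @[x --> F] --> \sum_(i <- s) a i.
Proof.
move=> fa; elim: s => [|i s IH].
  by under eq_cvg do rewrite big_nil; rewrite big_nil; exact: cvg_cst.
by under eq_cvg do rewrite big_cons; rewrite big_cons; exact: cvgD.
Qed.

Lemma continuous_mulr n (f g : 'rV[R]_n -> R) :
  continuous f -> continuous g -> continuous (fun x => f x * g x).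
Proof.
by move=> cf cg x; apply: (@cvgM _ _ (nbhs x)); [exact: cf|exact: cg].
Qed.

Lemma continuous_addr n (f g : 'rV[R]_n -> R) :
  continuous f -> continuous g -> continuous (fun x => f x + g x).
Proof.
by move=> cf cg x; apply: (@cvgD _ _ _ (nbhs x)); [exact: cf|exact: cg].
Qed.

Lemma continuous_pairing n (k : 'rV[int]_n) : continuous (@pairing R n k).
Proof.
move=> x; apply: (@cvgr_sum _ (nbhs x) (nbhs_filter x)) => j.
apply: (@cvgM _ _ (nbhs x)); first exact: cvg_cst.
exact: (@coord_continuous R 1 n 0 j x).
Qed.

Lemma continuous_cosp n (k : 'rV[int]_n) : continuous (@cosp n k).
Proof.
move=> x; apply: (@continuous_comp _ _ _ (pairing k) cos).
  exact: continuous_pairing.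
exact: continuous_cos.
Qed.

Lemma continuous_sinp n (k : 'rV[int]_n) : continuous (@sinp n k).
Proof.
move=> x; apply: (@continuous_comp _ _ _ (pairing k) sin).
  exact: continuous_pairing.
exact: continuous_sin.
Qed.

Lemma cosp_le1 n (k : 'rV[int]_n) x : `|cosp k x| <= 1.
Proof. by rewrite ler_norml cos_geN1 cos_le1. Qed.

Lemma sinp_le1 n (k : 'rV[int]_n) x : `|sinp k x| <= 1.
Proof. by rewrite ler_norml sin_geN1 sin_le1. Qed.

Lemma fbounded_cosp n (k : 'rV[int]_n) : fbounded (@cosp n k).
Proof. by exists 1 => x; exact: cosp_le1. Qed.

Lemma fbounded_sinp n (k : 'rV[int]_n) : fbounded (@sinp n k).
Proof. by exists 1 => x; exact: sinp_le1. Qed.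

Lemma tmeas_cosp n (k : 'rV[int]_n) : tmeas (@cosp n k).
Proof. by apply: tmeas_continuous; exact: continuous_cosp. Qed.

Lemma tmeas_sinp n (k : 'rV[int]_n) : tmeas (@sinp n k).
Proof. by apply: tmeas_continuous; exact: continuous_sinp. Qed.

Lemma tint_cosp n (k : 'rV[int]_n) : tint (@cosp n k).
Proof. by apply: tint_fbounded; [exact: tmeas_cosp|exact: fbounded_cosp]. Qed.

Lemma tint_sinp n (k : 'rV[int]_n) : tint (@sinp n k).
Proof. by apply: tint_fbounded; [exact: tmeas_sinp|exact: fbounded_sinp]. Qed.

Lemma is_derive_line n (u : 'rV[R]_n -> R^o) (x v : 'rV[R]_n) (l : R^o) :
  is_derive (0 : R) (1 : R) (fun r : R => u (r *: v + x)) l -> is_derive x v u l.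
Proof.
move=> [d dl].
have quo : (fun h : R => h^-1 *: (u (h *: v + x) - u x)) =
   (fun h : R => h^-1 *: (u ((h *: (1 : R) + 0) *: v + x) - u (0 *: v + x))).
  apply/funext => h; rewrite scale0r add0r; congr (_ *: (u (_ + _) - _)).
  by rewrite addr0 /GRing.scale /= mulr1.
split; first by rewrite /derivable /= quo; exact: d.
by rewrite -dl /derive /= quo.
Qed.

Lemma is_derive_cosp n (k : 'rV[int]_n) (i : 'I_n) (x : 'rV[R]_n) :
  is_derive x (delta_mx 0 i) (@cosp n k : _ -> R^o) (- (k 0 i)%:~R * sinp k x).
Proof.
apply: is_derive_line.
rewrite (_ : (fun r : R => _) = (fun r => cos ((k 0 i)%:~R * r + pairing k x))); last first.
  by apply/funext => r; rewrite /cosp pairingDr pairing_dir.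
apply: is_derive_eq; rewrite mulr0 add0r /GRing.scale /= /sinp; ring.
Qed.

Lemma is_derive_sinp n (k : 'rV[int]_n) (i : 'I_n) (x : 'rV[R]_n) :
  is_derive x (delta_mx 0 i) (@sinp n k : _ -> R^o) ((k 0 i)%:~R * cosp k x).
Proof.
apply: is_derive_line.
rewrite (_ : (fun r : R => _) = (fun r => sin ((k 0 i)%:~R * r + pairing k x))); last first.
  by apply/funext => r; rewrite /sinp pairingDr pairing_dir.
apply: is_derive_eq; rewrite mulr0 add0r /GRing.scale /= /cosp; ring.
Qed.

Lemma sinp0 n (x : 'rV[R]_n) : sinp 0 x = 0.
Proof. by rewrite /sinp pairing0l sin0. Qed.

Lemma cosp0 n (x : 'rV[R]_n) : cosp 0 x = 1.
Proof. by rewrite /cosp pairing0l cos0. Qed.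

Lemma torus_integral_sinp n (k : 'rV[int]_n) : torus_integral (@sinp n k) = 0.
Proof.
have [->|/rV0Pn[i ki]] := eqVneq k 0.
  by rewrite (_ : sinp 0 = fun=> 0) ?torus_integral_cst//; apply/funext => x; exact: sinp0.
have D : 'D_(delta_mx 0 i) (@cosp n k : _ -> R^o) = (fun x => - (k 0 i)%:~R * sinp k x).
  by apply/funext => x; have [] := is_derive_cosp k i x.
have := @torus_integral_derive0 n i (@cosp n k) (periodic_cosp k).
rewrite D torus_integralZ; last exact: tint_sinp.
move=> H; have : - (k 0 i)%:~R * torus_integral (sinp k) = 0 :> R.
  apply: H => [x|]; first by have [] := is_derive_cosp k i x.
  by apply: continuous_mulr; [exact: cst_continuous|exact: continuous_sinp].
by move/eqP; rewrite mulf_eq0 oppr_eq0 intr_eq0 (negbTE ki) => /eqP.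
Qed.

(** For k_i <> 0 the wave cos<k,x> is k_i^-1 times the i-th derivative of sin<k,x>. *)
Lemma torus_integral_cosp n (k : 'rV[int]_n) :
  torus_integral (@cosp n k) = (k == 0)%:R.
Proof.
have [->|/rV0Pn[i ki]] := eqVneq k 0.
  by rewrite (_ : cosp 0 = fun=> 1) ?torus_integral_cst//; apply/funext => x; exact: cosp0.
have D : 'D_(delta_mx 0 i) (@sinp n k : _ -> R^o) = (fun x => (k 0 i)%:~R * cosp k x).
  by apply/funext => x; have [] := is_derive_sinp k i x.
have := @torus_integral_derive0 n i (@sinp n k) (periodic_sinp k).
rewrite D torus_integralZ; last exact: tint_cosp.
move=> H; have : (k 0 i)%:~R * torus_integral (cosp k) = 0 :> R.
  apply: H => [x|]; first by have [] := is_derive_sinp k i x.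
  by apply: continuous_mulr; [exact: cst_continuous|exact: continuous_cosp].
by move/eqP; rewrite mulf_eq0 intr_eq0 (negbTE ki) => /eqP.
Qed.

Lemma cosp_cosp n (k l : 'rV[int]_n) x :
  cosp k x * cosp l x = 2^-1 * (cosp (k + l) x + cosp (k - l) x).
Proof. by rewrite /cosp !pairingDl pairingNl cosD cosB; field. Qed.

Lemma sinp_sinp n (k l : 'rV[int]_n) x :
  sinp k x * sinp l x = 2^-1 * (cosp (k - l) x - cosp (k + l) x).
Proof. by rewrite /cosp !pairingDl pairingNl cosB cosD /sinp; field. Qed.

Lemma sinp_cosp n (k l : 'rV[int]_n) x :
  sinp k x * cosp l x = 2^-1 * (sinp (k + l) x + sinp (k - l) x).
Proof. by rewrite /sinp /cosp !pairingDl pairingNl sinB sinD; field. Qed.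

Lemma torus_integral_cosp2 n (k l : 'rV[int]_n) :
  torus_integral (fun x => cosp k x * cosp l x) =
  2^-1 * ((k == - l)%:R + (k == l)%:R).
Proof.
under eq_fun do rewrite cosp_cosp.
have ? := tint_cosp.
rewrite torus_integralZ; last exact: tintD.
by rewrite torus_integralD// !torus_integral_cosp addr_eq0 subr_eq0.
Qed.

Lemma torus_integral_sinp2 n (k l : 'rV[int]_n) :
  torus_integral (fun x => sinp k x * sinp l x) =
  2^-1 * ((k == l)%:R - (k == - l)%:R).
Proof.
under eq_fun do rewrite sinp_sinp.
have ? := tint_cosp.
rewrite torus_integralZ; last exact: tintB.
by rewrite torus_integralB// !torus_integral_cosp subr_eq0 addr_eq0.
Qed.

Lemma torus_integral_sinp_cosp n (k l : 'rV[int]_n) :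
  torus_integral (fun x => sinp k x * cosp l x) = 0.
Proof.
under eq_fun do rewrite sinp_cosp.
have ? := tint_sinp.
rewrite torus_integralZ; last exact: tintD.
by rewrite torus_integralD// !torus_integral_sinp addr0 mulr0.
Qed.

Lemma tmeas_norm n (f : 'rV[R]_n -> R) : tmeas f -> tmeas (fun x => `|f x|).
Proof. by move=> mf; exact: measurableT_comp. Qed.

Lemma tint_norm n (f : 'rV[R]_n -> R) : tint f -> tint (fun x => `|f x|).
Proof.
move=> fi; apply: (le_tint (tmeas_norm (tint_tmeas fi)) fi) => x.
by rewrite normr_id.
Qed.

Lemma torus_integral_dominated n (f_ : nat -> 'rV[R]_n -> R) (f g : 'rV[R]_n -> R) :
  (forall N, tmeas (f_ N)) -> tmeas f -> tint g ->
  {ae torus_measure R n, forall t, f_ ^~ (tvec t) @ \oo --> f (tvec t)} ->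
  {ae torus_measure R n, forall t, forall N, `|f_ N (tvec t)| <= g (tvec t)} ->
  tint f /\ torus_integral (f_ N) @[N --> \oo] --> torus_integral f.
Proof.
move=> mf_ mf ig cf bf.
have [|||||fi _ H] := @dominated_convergence _ _ R (torus_measure R n) setT measurableT
    (fun N t => (f_ N (tvec t))%:E) (fun t => (f (tvec t))%:E) (fun t => (g (tvec t))%:E).
- by move=> N; apply/measurable_EFinP; exact: mf_.
- exact/measurable_EFinP.
- by apply: filterS cf => t ft _; apply: cvg_EFin => //; exact: nearW.
- exact: ig.
- by apply: filterS bf => t ft N _; rewrite /= lee_fin.
split => //; apply: fine_cvg; rewrite fineK //.
exact: integrable_fin_num.
Qed.

Lemma torus_aeS n (P Q : n.-tuple (measurableTypeR R) -> Prop) :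
  (forall t, P t -> Q t) -> {ae torus_measure R n, forall t, P t} ->
  {ae torus_measure R n, forall t, Q t}.
Proof. by move=> PQ; apply: negligibleS => t /= nQ Pt; exact/nQ/PQ. Qed.

End torus_integral_theory.

(** * Uniqueness of Fourier coefficients *)
Section uniqueness.
Context {R : realType}.
Implicit Types (n : nat).

Lemma bernoulli_ge (z : R) m : 0 <= z <= 1 -> 1 - m%:R * z <= (1 - z) ^+ m.
Proof.
move=> /andP[z0 z1]; elim: m => [|m IH]; first by rewrite mul0r subr0 expr0.
rewrite exprS; apply: (@le_trans _ _ ((1 - z) * (1 - m%:R * z))); last first.
  by rewrite ler_wpM2l// subr_ge0.
rewrite -[m.+1%:R]natr1.
have : 0 <= m%:R * (z * z) by rewrite !mulr_ge0.
nra.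
Qed.

Lemma bernoulli_le (z : R) m : 0 <= z <= 1 -> (1 - z) ^+ m * (1 + m%:R * z) <= 1.
Proof.
move=> /andP[z0 z1].
have h : 1 + m%:R * z <= (1 + z) ^+ m.
  elim: m => [|m IH]; first by rewrite mul0r addr0 expr0.
  rewrite exprS; apply: (@le_trans _ _ ((1 + z) * (1 + m%:R * z))); last first.
    by rewrite ler_wpM2l// addr_ge0.
  rewrite -[m.+1%:R]natr1.
  have : 0 <= m%:R * (z * z) by rewrite !mulr_ge0.
  nra.
apply: (@le_trans _ _ ((1 - z) ^+ m * (1 + z) ^+ m)).
  by rewrite ler_wpM2l// exprn_ge0// subr_ge0.
rewrite -exprMn exprn_ile1//; nra.
Qed.

Lemma cvg_natr_expr (r : R) : 0 <= r < 1 -> (fun N => N%:R * r ^+ N) @ \oo --> (0 : R).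
Proof.
move=> /andP[r0 r1].
pose q := Num.sqrt r.
have q0 : 0 <= q by exact: sqrtr_ge0.
have qq : q * q = r by rewrite -expr2 sqr_sqrtr.
have q1 : q < 1 by nra.
pose C := (1 - q)^-1.
have bd N : N%:R * q ^+ N <= C.
  have := @bernoulli_le (1 - q) N; rewrite subKr => h.
  have {}h : q ^+ N * (1 + N%:R * (1 - q)) <= 1 by apply: h; apply/andP; split; lra.
  rewrite /C -[leRHS]mul1r ler_pdivlMr ?subr_gt0//.
  have : 0 <= q ^+ N by exact: exprn_ge0.
  by move: h; rewrite mulrDr mulr1 mulrCA mulrA; lra.
apply: (@squeeze_cvgr _ _ _ R (fun=> 0) (fun N => C * q ^+ N)).
- apply: nearW => N; rewrite mulr_ge0 ?exprn_ge0//=.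
  rewrite -qq exprMn mulrA ler_wpM2r ?exprn_ge0//.
- exact: cvg_cst.
- rewrite -[X in _ --> X](mulr0 C); apply: cvgM; first exact: cvg_cst.
  by apply: cvg_expr; rewrite ger0_norm.
Qed.

(** The polynomials (1 - y^N)^(N 2^N) converge on [0, 1] to a step at 1/2, because
the quantity N 2^N y^N = N (2y)^N tends to 0 below 1/2 and to infinity from 1/2 on; the
two Bernoulli inequalities turn this into the limits 1 and 0. *)
Lemma cvg_step (y : R) : 0 <= y <= 1 ->
  (fun N => (1 - y ^+ N) ^+ (N * 2 ^ N)) @ \oo --> ((y < 2^-1)%R%:R : R).
Proof.
move=> /andP[y0 y1].
have z01 N : 0 <= y ^+ N <= 1 by rewrite exprn_ge0 ?exprn_ile1.
have le1 N : (1 - y ^+ N) ^+ (N * 2 ^ N) <= 1.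
  by have /andP[h1 h2] := z01 N; rewrite exprn_ile1//; lra.
have ge0 N : 0 <= (1 - y ^+ N) ^+ (N * 2 ^ N).
  by have /andP[h1 h2] := z01 N; rewrite exprn_ge0//; lra.
have E N : (N * 2 ^ N)%:R * y ^+ N = N%:R * (2 * y) ^+ N.
  by rewrite natrM natrX exprMn mulrA.
have [yh|yh] := ltP y 2^-1.
- apply: (@squeeze_cvgr _ _ _ R (fun N => 1 - N%:R * (2 * y) ^+ N) (fun=> 1)).
  + by apply: nearW => N; rewrite le1 andbT -E bernoulli_ge.
  + rewrite -[X in _ --> X]subr0; apply: cvgB; first exact: cvg_cst.
    apply: cvg_natr_expr; apply/andP; split; lra.
  + exact: cvg_cst.
- apply: (@squeeze_cvgr _ _ _ R (fun=> 0) (fun N => N.+1%:R^-1)).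
  + apply: nearW => N; rewrite ge0/= -[leRHS]mul1r ler_pdivlMr//.
    apply: le_trans (bernoulli_le (N * 2 ^ N) (z01 N)).
    rewrite ler_wpM2l// E -natr1 addrC lerD2l ler_peMr//.
    by rewrite exprn_ege1//; lra.
  + exact: cvg_cst.
  + exact: cvg_harmonic.
Qed.

Inductive trigpoly n : ('rV[R]_n -> R) -> Prop :=
| trigpoly_cosp k : trigpoly (cosp k)
| trigpoly_sinp k : trigpoly (sinp k)
| trigpolyD p q : trigpoly p -> trigpoly q -> trigpoly (fun x => p x + q x)
| trigpolyZ c p : trigpoly p -> trigpoly (fun x => c * p x).

Lemma trigpoly_ext n (p q : 'rV[R]_n -> R) : trigpoly p -> p =1 q -> trigpoly q.
Proof. by move=> tp /funext <-. Qed.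

Lemma trigpolyM n (p q : 'rV[R]_n -> R) :
  trigpoly p -> trigpoly q -> trigpoly (fun x => p x * q x).
Proof.
elim=> [k|k|p1 p2 _ IH1 _ IH2|c p1 _ IH] tq.
- elim: tq => [l|l|q1 q2 _ IH1 _ IH2|c q1 _ IH].
  + apply: (@trigpoly_ext _ (fun x => 2^-1 * (cosp (k + l) x + cosp (k - l) x))).
      by apply/trigpolyZ/trigpolyD; exact: trigpoly_cosp.
    by move=> x; rewrite cosp_cosp.
  + apply: (@trigpoly_ext _ (fun x => 2^-1 * (sinp (l + k) x + sinp (l - k) x))).
      by apply/trigpolyZ/trigpolyD; exact: trigpoly_sinp.
    by move=> x; rewrite -sinp_cosp mulrC.
  + by apply: trigpoly_ext (trigpolyD IH1 IH2) _ => x; rewrite mulrDr.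
  + by apply: trigpoly_ext (trigpolyZ c IH) _ => x; rewrite mulrCA.
- elim: tq => [l|l|q1 q2 _ IH1 _ IH2|c q1 _ IH].
  + apply: (@trigpoly_ext _ (fun x => 2^-1 * (sinp (k + l) x + sinp (k - l) x))).
      by apply/trigpolyZ/trigpolyD; exact: trigpoly_sinp.
    by move=> x; rewrite sinp_cosp.
  + apply: (@trigpoly_ext _ (fun x => 2^-1 * (cosp (k - l) x + (-1) * cosp (k + l) x))).
      by apply/trigpolyZ/trigpolyD; [|apply: trigpolyZ]; exact: trigpoly_cosp.
    by move=> x; rewrite sinp_sinp mulN1r.
  + by apply: trigpoly_ext (trigpolyD IH1 IH2) _ => x; rewrite mulrDr.
  + by apply: trigpoly_ext (trigpolyZ c IH) _ => x; rewrite mulrCA.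
- by apply: trigpoly_ext (trigpolyD (IH1 tq) (IH2 tq)) _ => x; rewrite mulrDl.
- by apply: trigpoly_ext (trigpolyZ c (IH tq)) _ => x; rewrite mulrA.
Qed.

Lemma trigpoly_cst n c : trigpoly (fun _ : 'rV[R]_n => c).
Proof.
apply: trigpoly_ext (trigpolyZ c (trigpoly_cosp (0 : 'rV[int]_n))) _ => x.
by rewrite cosp0 mulr1.
Qed.

Lemma trigpolyX n (p : 'rV[R]_n -> R) m :
  trigpoly p -> trigpoly (fun x => p x ^+ m).
Proof.
move=> tp; elim: m => [|m IH].
  by apply: trigpoly_ext (trigpoly_cst n 1) _ => x; rewrite expr0.
by apply: trigpoly_ext (trigpolyM tp IH) _ => x; rewrite exprS.
Qed.

Lemma trigpoly_continuous n (p : 'rV[R]_n -> R) : trigpoly p -> continuous p.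
Proof.
elim=> [k|k|p1 p2 _ IH1 _ IH2|c p1 _ IH].
- exact: continuous_cosp.
- exact: continuous_sinp.
- exact: continuous_addr.
- by apply: continuous_mulr => //; exact: cst_continuous.
Qed.

Lemma trigpoly_cos_coord n (j : 'I_n) (c : R) :
  trigpoly (fun x : 'rV[R]_n => cos (x 0 j - c)).
Proof.
apply: trigpoly_ext (trigpolyD (trigpolyZ (cos c) (trigpoly_cosp (delta_mx 0 j)))
  (trigpolyZ (sin c) (trigpoly_sinp (delta_mx 0 j)))) _ => x.
by rewrite /cosp /sinp pairing_delta cosB; ring.
Qed.

(** Uniformly bounded pointwise limits are what dominated convergence transfers
orthogonality to.  The class is closed under products and complements, and contains
indicators of boxes up to a negligible set, which is all that a Dynkin argument needs. *)
Definition trig_limit n (w : 'rV[R]_n -> R) : Prop :=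
  exists p : nat -> 'rV[R]_n -> R,
    [/\ forall N, trigpoly (p N), exists M, forall N x, `|p N x| <= M
      & forall x, p ^~ x @ \oo --> w x].

Lemma trig_limit_cst n c : trig_limit (fun _ : 'rV[R]_n => c).
Proof.
exists (fun _ _ => c); split; [by move=> _; exact: trigpoly_cst|by exists `|c| |].
by move=> x; exact: cvg_cst.
Qed.

Lemma trig_limitM n (v w : 'rV[R]_n -> R) :
  trig_limit v -> trig_limit w -> trig_limit (fun x => v x * w x).
Proof.
move=> [p [tp [M pM] pv]] [q [tq [N qN] qw]].
exists (fun i x => p i x * q i x); split.
- by move=> i; exact: trigpolyM.
- by exists (M * N) => i x; rewrite normrM ler_pM.
- by move=> x; exact: cvgM.
Qed.

Lemma trig_limitN1 n (v : 'rV[R]_n -> R) :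
  trig_limit v -> trig_limit (fun x => 1 - v x).
Proof.
move=> [p [tp [M pM] pv]].
exists (fun i x => 1 + (-1) * p i x); split.
- by move=> i; apply: trigpolyD; [exact: trigpoly_cst|exact: trigpolyZ].
- exists (1 + M) => i x; rewrite (le_trans (ler_normD _ _))// normr1 lerD2l.
  by rewrite mulN1r normrN.
- move=> x; under eq_fun do rewrite mulN1r.
  by apply: cvgB => //; exact: cvg_cst.
Qed.

(** The step polynomials are applied to y = (1 - cos(x_j - c)) / 2, which lies in [0, 1]
and is below 1/2 exactly on the half circle cos(x_j - c) > 0. *)
Lemma trig_limit_halfspace n (j : 'I_n) (c : R) :
  trig_limit (fun x : 'rV[R]_n => (0 < cos (x 0 j - c))%R%:R).
Proof.
pose y (x : 'rV[R]_n) := 2^-1 + (- 2^-1) * cos (x 0 j - c).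
have y01 x : 0 <= y x <= 1.
  have := cos_le1 (x 0 j - c); have := cos_geN1 (x 0 j - c); rewrite /y => h1 h2.
  by apply/andP; split; lra.
have ty : trigpoly y.
  by apply: trigpolyD; [exact: trigpoly_cst|apply: trigpolyZ; exact: trigpoly_cos_coord].
exists (fun N x => (1 + (-1) * y x ^+ N) ^+ (N * 2 ^ N)); split.
- move=> N; apply: trigpolyX; apply: trigpolyD; first exact: trigpoly_cst.
  by apply: trigpolyZ; exact: trigpolyX.
- exists 1 => N x; rewrite mulN1r normrX exprn_ile1//.
  have /andP[h1 h2] := y01 x.
  have h3 : 0 <= y x ^+ N by exact: exprn_ge0.
  have h4 : y x ^+ N <= 1 by exact: exprn_ile1.
  by rewrite ger0_norm; lra.
- move=> x; rewrite (_ : (0 < cos _)%R = (y x < 2^-1)%R).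
    by under eq_fun do rewrite mulN1r; exact: cvg_step.
  by rewrite /y; apply/idP/idP; lra.
Qed.

Lemma sin_gt0E (y : R) : 0 < y < 2 * pi -> (0 < sin y) = (y < pi).
Proof.
move=> /andP[y0 y2]; have [yp|yp] := ltP y pi.
  by apply: sin_gt0_pi; rewrite y0.
apply/negbTE; rewrite -leNgt -[y](subrK pi) sinDpi oppr_le0.
by apply: sin_ge0_pi; rewrite subr_ge0 yp/=; lra.
Qed.

Lemma cos_sin_shift (x c : R) : cos (x - (c + pi / 2)) = sin (x - c).
Proof.
by rewrite -sinDpihalf; congr sin; lra.
Qed.

(** Half circles generate arcs: inside ]0, 2 pi[, the arc x_j < c is the intersection
of two half circles when c <= pi, and the complement of the part of one half circle
outside another when c > pi. *)
Lemma trig_limit_ray n (j : 'I_n) (c : R) :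
  exists2 w, trig_limit w & forall x : 'rV[R]_n,
    0 < x 0 j < 2 * pi -> w x = (x 0 j < c)%R%:R.
Proof.
pose S a (x : 'rV[R]_n) : R := (0 < cos (x 0 j - (a + pi / 2)))%R%:R.
have lS a : trig_limit (S a) by exact: trig_limit_halfspace.
have SE a x : S a x = (0 < sin (x 0 j - a))%R%:R by rewrite /S cos_sin_shift.
have p0 := @pi_gt0 R.
have [c0|c0] := leP c 0.
  exists (fun=> 0); first exact: trig_limit_cst.
  by move=> x /andP[x0 _]; rewrite ltNge (le_trans c0 (ltW x0)).
have [c2|c2] := leP (2 * pi) c.
  exists (fun=> 1); first exact: trig_limit_cst.
  by move=> x /andP[_ x2]; rewrite (lt_le_trans x2 c2).
have [cp|cp] := leP c pi.
  exists (fun x => S 0 x * S (c - pi) x); first exact: trig_limitM.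
  move=> x /andP[x0 x2]; rewrite !SE subr0 sin_gt0E ?x0//.
  have [xp|xp] := ltP (x 0 j) pi; last first.
    by rewrite mul0r ltNge (le_trans cp xp).
  rewrite mul1r sin_gt0E; first by congr (nat_of_bool _)%:R; apply/idP/idP; lra.
  by apply/andP; split; lra.
exists (fun x => 1 - S pi x * (1 - S (c - pi) x)).
  by apply/trig_limitN1/trig_limitM => //; exact: trig_limitN1.
move=> x /andP[x0 x2]; rewrite !SE.
have [xp|xp] := leP (x 0 j) pi.
  rewrite (_ : (0 < sin (x 0 j - pi)) = false) ?mul0r ?subr0 ?(le_lt_trans xp cp)//.
  apply/negbTE; rewrite -leNgt -[x 0 j - pi]opprB sinN oppr_le0.
  by apply: sin_ge0_pi; apply/andP; split; lra.
rewrite sin_gt0E ?subr_gt0 ?xp/=; last by lra.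
rewrite (_ : x 0 j - pi < pi); last by lra.
rewrite mul1r subKr sin_gt0E; last by apply/andP; split; lra.
by congr (nat_of_bool _)%:R; apply/idP/idP; lra.
Qed.

Lemma trig_limit_rays n (L : seq ('I_n * R)) :
  exists2 w, trig_limit w & forall x : 'rV[R]_n,
    (forall j, 0 < x 0 j < 2 * pi) -> w x = (all (fun p => (x 0 p.1 < p.2)%R) L)%:R.
Proof.
elim: L => [|[j c] L [w lw wE]].
  by exists (fun=> 1) => //; exact: trig_limit_cst.
have [v lv vE] := trig_limit_ray j c.
exists (fun x => v x * w x); first exact: trig_limitM.
by move=> x xc; rewrite vE// wE//= -natrM mulnb.
Qed.

Section orthogonal.
Variables (n : nat) (h : 'rV[R]_n -> R).
Hypothesis (hi : tint h).
Hypothesis hcos : forall k, torus_integral (fun x => h x * cosp k x) = 0.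
Hypothesis hsin : forall k, torus_integral (fun x => h x * sinp k x) = 0.

Lemma trigpoly_bounded (p : 'rV[R]_n -> R) : trigpoly p -> fbounded p.
Proof.
elim=> [k|k|p1 p2 _ IH1 _ IH2|c p1 _ IH].
- exact: fbounded_cosp.
- exact: fbounded_sinp.
- exact: fboundedD.
- by apply: fboundedM => //; exact: fbounded_cst.
Qed.

Lemma trigpoly_tmeas (p : 'rV[R]_n -> R) : trigpoly p -> tmeas p.
Proof. by move=> tp; apply: tmeas_continuous; exact: trigpoly_continuous. Qed.

Lemma trigpoly_tintM (p : 'rV[R]_n -> R) : trigpoly p -> tint (fun x => h x * p x).
Proof.
by move=> tp; apply: tintM => //; [exact: trigpoly_tmeas|exact: trigpoly_bounded].
Qed.

Lemma orthogonal_trigpoly (p : 'rV[R]_n -> R) :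
  trigpoly p -> torus_integral (fun x => h x * p x) = 0.
Proof.
elim=> [k|k|p1 p2 tp1 IH1 tp2 IH2|c p1 tp IH]; first exact: hcos.
- exact: hsin.
- under eq_fun do rewrite mulrDr.
  by rewrite torus_integralD ?IH1 ?IH2 ?addr0//; exact: trigpoly_tintM.
- under eq_fun do rewrite mulrCA.
  by rewrite torus_integralZ ?IH ?mulr0//; exact: trigpoly_tintM.
Qed.

Lemma trig_limit_tmeas (w : 'rV[R]_n -> R) : trig_limit w -> tmeas w.
Proof.
move=> [p [tp _ pw]].
apply: (measurable_fun_cvg (h := fun N t => p N (tvec t))).
  by move=> N; exact: trigpoly_tmeas.
by move=> t _; exact: pw.
Qed.

Lemma orthogonal_trig_limit (w : 'rV[R]_n -> R) : trig_limit w ->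
  (\int[torus_measure R n]_t (h (tvec t) * w (tvec t))%:E = 0)%E.
Proof.
move=> lw; have mw := trig_limit_tmeas lw; case: lw => [p [tp [M pM] pw]].
have mh : tmeas h by exact: tint_tmeas.
have [] := @torus_integral_dominated _ n (fun N x => h x * p N x)
  (fun x => h x * w x) (fun x => M * `|h x|).
- by move=> N; apply: tmeasM => //; exact: trigpoly_tmeas.
- exact: tmeasM.
- by apply: tintZ; exact: tint_norm.
- by apply: aeW => t; apply: cvgM; [exact: cvg_cst|exact: pw].
- by apply: aeW => t N; rewrite normrM mulrC ler_wpM2r.
move=> hwi; under eq_cvg do rewrite orthogonal_trigpoly//.
move/cvg_lim => /(_ (@Rhausdorff R)); rewrite lim_cst// => H.
rewrite -[LHS]fineK; last exact: integrable_fin_num.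
by congr _%:E; exact/esym/H.
Qed.

(** Conditions x_j < c for finitely many pairs (j, c), as a list so that intersection is
concatenation: a family stable under intersection that generates the product
sigma-algebra. *)
Definition rays (L : seq ('I_n * R)) : set (n.-tuple (measurableTypeR R)) :=
  [set t | all (fun p => tnth t p.1 < p.2)%R L].

Lemma measurable_raysE :
  @measurable _ (n.-tuple (measurableTypeR R)) = <<s range rays >>.
Proof.
have sub L : measurable (rays L).
  elim: L => [|[j c] L IH]; first by rewrite (_ : rays [::] = setT)//; apply/seteqP.
  rewrite (_ : rays _ = (fun t => tnth t j) @^-1` `]-oo, c[ `&` rays L).
    apply: measurableI => //.
    by rewrite -[X in measurable X]setTI; apply: measurable_tnth.
  by apply/seteqP; split => t /=; rewrite /rays/= in_itv/= => /andP.
apply/seteqP; split; last first.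
  apply: smallest_sub; first exact: sigma_algebra_measurable.
  by move=> _ [L _ <-].
apply: smallest_sub; first exact: smallest_sigma_algebra.
rewrite -bigcup_seq; apply: bigcup_sub => j _ _ [B mB <-].
rewrite setTI.
suff : <<s @RGenInftyO.G R >> `<=`
    [set B | <<s range rays>> ((fun t => tnth t j) @^-1` B)].
  by apply; exact: (eq_ind _ (fun S => S B) mB _ (RGenInftyO.measurableE R)).
apply: smallest_sub.
  have [s0 sC sU] := smallest_sigma_algebra setT (range rays).
  split => /=.
  - by rewrite preimage_set0.
  - by move=> A; rewrite !setTD preimage_setC -setTD; exact: sC.
  - by move=> A HA; rewrite preimage_bigcup; exact: sU.
move=> _ [c ->] /=.
apply: sub_sigma_algebra; exists [:: (j, c)] => //.
by apply/seteqP; split => t /=; rewrite /rays/= in_itv/= andbT.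
Qed.

(** The sets over which h integrates to 0 form a Dynkin class.  It contains every set of
the family rays, whose indicator is a trigonometric limit almost everywhere, hence it
contains every measurable set; then h vanishes almost everywhere. *)
Lemma orthogonal_ae0 :
  {ae torus_measure R n, forall t, h (tvec t) = 0}.
Proof.
set mu := torus_measure R n.
have intT0 : (\int[mu]_t (h (tvec t))%:E = 0)%E.
  have := orthogonal_trig_limit (trig_limit_cst n 1).
  by under eq_integral do rewrite mulr1.
have key S : measurable S -> (\int[mu]_(t in S) (h (tvec t))%:E = 0)%E.
  rewrite measurable_raysE; move: S.
  apply: (@dynkin_induction _ (n.-tuple (measurableTypeR R)) (range rays)).
  - exact: measurable_raysE.
  - move=> _ _ [L _ <-] [L' _ <-]; exists (L ++ L') => //.
    by apply/seteqP; split => t; rewrite /rays/= all_cat => /andP.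
  - exact: intT0.
  - move=> _ [L _ <-] /=.
    have [w lw wE] := trig_limit_rays L.
    rewrite integral_mkcond -[RHS](orthogonal_trig_limit lw).
    have mh : tmeas h by exact: tint_tmeas.
    have mw : tmeas w by exact: trig_limit_tmeas.
    have mL : measurable (rays L).
      by rewrite measurable_raysE; apply: sub_sigma_algebra; exists L.
    apply: ae_eq_integral => //.
    + apply: (measurable_restrictT _ mL).1; apply: measurable_funTS.
      exact/measurable_EFinP.
    + by apply/measurable_EFinP; exact: tmeasM.
    + apply: torus_aeS (@ae_torus_coord R n) => t ht _.
      rewrite /patch wE; last by move=> j; rewrite mxE.
      have -> : (t \in rays L) = all (fun p => (tvec t 0 p.1 < p.2)%R) L.
        have E : (fun p : 'I_n * R => (tvec t 0 p.1 < p.2)%R) =1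
                 (fun p => (tnth t p.1 < p.2)%R) by move=> p; rewrite mxE.
        by rewrite (eq_all E); apply/idP/idP => [/set_mem|H]; last exact: mem_set.
      by case: ifP => _; rewrite ?mulr1 ?mulr0.
  - move=> S mS S0.
    have : (\int[mu]_(t in S `|` ~` S) (h (tvec t))%:E = 0)%E by rewrite setUv.
    rewrite integral_setU//; first by rewrite S0 add0e.
    + exact: measurableC.
    + by rewrite setUv; apply/measurable_EFinP; exact: tint_tmeas.
    + by apply/disj_setPCl.
  - move=> F mF tF F0.
    rewrite integral_bigcup//; first by rewrite eseries0.
    apply: integrableS hi => //; exact: bigcupT_measurable.
have : ae_eq mu setT (fun t => (h (tvec t))%:E) (cst 0%E).
  apply: integral_ae_eq => //.
  by move=> E _ mE; rewrite key// integral0.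
by apply: torus_aeS => t /(_ I) /= [].
Qed.
End orthogonal.
End uniqueness.

(** * Dominated series *)
Section tannery.
Context {R : realType}.

Lemma is_cvg_series_dom (u M : nat -> R) :
  cvgn (series M) -> (forall i, `|u i| <= M i) -> cvgn (series u).
Proof.
move=> cM uM; apply: normed_cvg.
apply: (@series_le_cvg _ _ M) => // i /=; rewrite ?normr_ge0//.
by apply: le_trans (uM i); exact: normr_ge0.
Qed.

Lemma series_tail (u M : nat -> R) N :
  cvgn (series M) -> (forall i, `|u i| <= M i) ->
  `|limn (series u) - series u N| <= limn (series M) - series M N.
Proof.
move=> cM uM.
have cu := is_cvg_series_dom cM uM.
have cl : (fun m => `|series u m - series u N|) @ \oo --> `|limn (series u) - series u N|.
  by apply: cvg_norm; apply: cvgB => //; exact: cvg_cst.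
have cr : (fun m => series M m - series M N) @ \oo --> limn (series M) - series M N.
  by apply: cvgB => //; exact: cvg_cst.
apply: (ler_cvg_to cl cr); near=> m.
have Nm : (N <= m)%N by near: m; exact: nbhs_infty_ge.
rewrite !sub_series Nm (le_trans (ler_norm_sum _ _ _))//.
by apply: ler_sum => i _; exact: uM.
Unshelve. all: by end_near. Qed.

(** Dominated convergence for series: the tails are uniformly small, and a finite partial
sum passes to the limit.  It gives both continuity and termwise differentiation of
wave series. *)
Lemma tannery (X : Type) (F : set_system X) (FF : Filter F) (T : nat -> X -> R)
    (L M : nat -> R) :
  cvgn (series M) -> (forall i x, `|T i x| <= M i) -> (forall i, `|L i| <= M i) ->
  (forall i, T i x @[x --> F] --> L i) ->
  limn (series (T ^~ x)) @[x --> F] --> limn (series L).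
Proof.
move=> cM TM LM TL.
apply/cvgrPdist_le => /= e e0.
have e30 : 0 < e / 3 by rewrite divr_gt0.
have /cvgrPdist_le /(_ _ e30) [N _ hN] := cM.
have {hN} tailN : limn (series M) - series M N <= e / 3.
  by apply: le_trans (hN N (leqnn N)); exact: ler_norm.
have cN : (fun x => series (T ^~ x) N) @ F --> series L N.
  rewrite /series/=; exact: cvgr_sum.
have /cvgrPdist_le /(_ _ e30) nN := cN.
apply: filterS nN => x hx.
have h1 := series_tail N cM LM.
have h2 := series_tail N cM (TM ^~ x).
have -> : limn (series L) - limn (series (T^~ x)) =
  (limn (series L) - series L N) + (series L N - series (T^~ x) N)
   - (limn (series (T^~ x)) - series (T^~ x) N) by ring.
rewrite (le_trans (ler_normB _ _))// (le_trans (lerD (ler_normD _ _) (lexx _)))//.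
move: h1 h2 hx tailN; rewrite /=.
set A := `|_|; set B := `|_|; set C := `|_|; set D := _ - _ => h1 h2 h3 h4.
have -> : e = e / 3 + e / 3 + e / 3 by field.
by rewrite !lerD// (le_trans _ h4).
Qed.

Lemma sin_lipschitz (x y : R) : `|sin x - sin y| <= `|x - y|.
Proof.
wlog xy : x y / x <= y => [hw|].
  have [|/ltW] := leP x y; first exact: hw.
  by move=> yx; rewrite -normrN opprB -[leRHS]normrN opprB; exact: hw.
have [z _] := @MVT_segment R sin cos x y xy (fun z _ => is_derive_sin z)
   (continuous_subspaceT (@continuous_sin R)).
move=> E; rewrite -normrN opprB E -[leRHS]normrN opprB normrM ler_piMl//.
by rewrite ler_norml cos_geN1 cos_le1.
Qed.

Lemma cos_lipschitz (x y : R) : `|cos x - cos y| <= `|x - y|.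
Proof.
rewrite -!sinDpihalf (le_trans (sin_lipschitz _ _))//.
by rewrite opprD addrACA subrr addr0.
Qed.

End tannery.

(** * Absolutely summable wave series *)
Section wave_series.
Context {R : realType} {n : nat}.
Variables (S : nat -> seq 'rV[int]_n) (lev : 'rV[int]_n -> nat).
Hypothesis memS : forall nu k, (k \in S nu) = (lev k == nu).
Hypothesis uniqS : forall nu, uniq (S nu).

(** The lattice is enumerated by finite levels S nu; only the sums of whole levels are
ordered into a series. *)
Definition block (a b : 'rV[int]_n -> R) (nu : nat) (x : 'rV[R]_n) : R :=
  \sum_(k <- S nu) (a k * cosp k x + b k * sinp k x).

Definition wave_series (a b : 'rV[int]_n -> R) (x : 'rV[R]_n) : R :=
  limn (series (fun nu => block a b nu x)).

(** The factor is |k| + 1 and not |k| so that the weight increases with l at k = 0 too. *)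
Definition wave_weight (l : nat) (a b : 'rV[int]_n -> R) (nu : nat) : R :=
  \sum_(k <- S nu) (`|a k| + `|b k|) * (l1norm k).+1%:R ^+ l.

Definition wave_summable (l : nat) (a b : 'rV[int]_n -> R) : Prop :=
  cvgn (series (wave_weight l a b)).

Lemma le_coord_l1norm (k : 'rV[int]_n) i : `|(k 0 i)%:~R| <= (l1norm k)%:R :> R.
Proof.
rewrite -intr_norm /l1norm (bigD1 i)//= natrD -abszE -pmulrn.
by rewrite lerDl.
Qed.

Lemma le_coord_l1normS (k : 'rV[int]_n) i : `|(k 0 i)%:~R| <= (l1norm k).+1%:R :> R.
Proof. by rewrite (le_trans (le_coord_l1norm _ _))// ler_nat. Qed.

Lemma l1norm_ge1 (k : 'rV[int]_n) : k != 0 -> (0 < l1norm k)%N.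
Proof.
move/rV0Pn => [i ki]; rewrite /l1norm (bigD1 i)//=.
by rewrite addn_gt0 absz_gt0 ki.
Qed.

Lemma block_le a b nu x : `|block a b nu x| <= wave_weight 0 a b nu.
Proof.
rewrite (le_trans (ler_norm_sum _ _ _))//; apply: ler_sum => k _.
rewrite expr0 mulr1 (le_trans (ler_normD _ _))// !normrM.
by rewrite lerD// ler_piMr ?cosp_le1 ?sinp_le1.
Qed.

Lemma continuous_block a b nu : continuous (block a b nu).
Proof.
move=> x; apply: (@cvgr_sum _ _ (nbhs x) (nbhs_filter x)) => k.
by apply: (@cvgD _ _ _ (nbhs x)); apply: (@cvgM _ _ (nbhs x)); first [exact: cvg_cst
  | exact: continuous_cosp | exact: continuous_sinp].
Qed.

Lemma periodic_block a b nu : torus_periodic (block a b nu).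
Proof.
by move=> l x; apply: eq_bigr => k _; rewrite periodic_cosp periodic_sinp.
Qed.

Lemma periodic_wave_series a b : torus_periodic (wave_series a b).
Proof.
by move=> l x; rewrite /wave_series; under eq_fun do rewrite periodic_block.
Qed.

Lemma continuous_wave_series a b : wave_summable 0 a b -> continuous (wave_series a b).
Proof.
move=> sab x.
apply: (@tannery R _ (nbhs x) (nbhs_filter x) (block a b) (fun nu => block a b nu x) _ sab).
- exact: block_le.
- by move=> nu; exact: block_le.
- by move=> nu; exact: continuous_block.
Qed.

Lemma cvg_wave_series a b x : wave_summable 0 a b -> cvgn (series (fun nu => block a b nu x)).
Proof. by move=> sab; apply: is_cvg_series_dom sab _ => nu; exact: block_le. Qed.

(** The coefficients of the i-th partial derivative: (a_k, b_k) becomes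
(k_i b_k, - k_i a_k). *)
Definition dcoef (i : 'I_n) (c : ('rV[int]_n -> R) * ('rV[int]_n -> R)) :=
  (fun k : 'rV[int]_n => (k 0 i)%:~R * c.2 k,
   fun k : 'rV[int]_n => - (k 0 i)%:~R * c.1 k).

Lemma weight_dcoef l i c nu :
  wave_weight l (dcoef i c).1 (dcoef i c).2 nu <= wave_weight l.+1 c.1 c.2 nu.
Proof.
apply: ler_sum => k _; rewrite /= exprS mulrA ler_wpM2r ?exprn_ge0//.
rewrite !normrM normrN -mulrDr addrC mulrC ler_wpM2l ?addr_ge0//.
exact: le_coord_l1normS.
Qed.

Lemma weight_ge0 l a b nu : 0 <= wave_weight l a b nu.
Proof. by apply: sumr_ge0 => k _; rewrite mulr_ge0 ?addr_ge0 ?exprn_ge0. Qed.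

Lemma summable_dcoef l i c :
  wave_summable l.+1 c.1 c.2 -> wave_summable l (dcoef i c).1 (dcoef i c).2.
Proof.
move=> h; apply: is_cvg_series_dom h _ => nu.
by rewrite ger0_norm ?weight_ge0 ?weight_dcoef.
Qed.

Lemma summable_le l m a b : (l <= m)%N -> wave_summable m a b -> wave_summable l a b.
Proof.
move=> lm h; apply: is_cvg_series_dom h _ => nu.
rewrite ger0_norm ?weight_ge0//; apply: ler_sum => k _.
by rewrite ler_wpM2l ?addr_ge0// ler_weXn2l// ler1n.
Qed.

(** Termwise differentiation.  Since cos and sin are 1-Lipschitz, the difference
quotients of a level are dominated by its weight of order 1, and Tannery's theorem
exchanges the limit of the quotients with the series. *)
Lemma is_derive_wave_series i c (x : 'rV[R]_n) : wave_summable 1 c.1 c.2 ->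
  is_derive x (delta_mx 0 i) (wave_series c.1 c.2 : _ -> R^o)
    (wave_series (dcoef i c).1 (dcoef i c).2 x).
Proof.
case: c => a b /= s1; have s0 := summable_le (leq0n 1) s1.
pose T nu (h : R) := h^-1 * (block a b nu (h *: delta_mx 0 i + x) - block a b nu x).
have TE : (fun h : R => h^-1 *: ((wave_series a b \o shift x) (h *: delta_mx 0 i)
     - wave_series a b x)) = (fun h : R => limn (series (T ^~ h))).
  apply/funext => h; rewrite /wave_series /= -lim_seriesB; [|exact: cvg_wave_series..].
  rewrite -lim_seriesZ; last by apply: is_cvg_seriesB; exact: cvg_wave_series.
  by [].
have cT : limn (series (T ^~ h)) @[h --> 0^'] -->
    limn (series (fun nu => block (dcoef i (a, b)).1 (dcoef i (a, b)).2 nu x)).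
  apply: (@tannery R _ _ (dnbhs_filter _) T (fun nu => block (dcoef i (a, b)).1 (dcoef i (a, b)).2 nu x) _ s1).
  - move=> nu h; rewrite /T normrM /block -sumrB.
    have [->|h0] := eqVneq h 0.
      by rewrite invr0 normr0 mul0r weight_ge0.
    rewrite normfV ler_pdivrMl ?normr_gt0// /wave_weight mulr_sumr.
    rewrite (le_trans (ler_norm_sum _ _ _))//; apply: ler_sum => k _.
    rewrite opprD addrACA -!mulrBr (le_trans (ler_normD _ _))//.
    have -> : `|h| * ((`|a k| + `|b k|) * (l1norm k).+1%:R ^+ 1) =
      `|a k| * (`|h| * (l1norm k).+1%:R) + `|b k| * (`|h| * (l1norm k).+1%:R) by ring.
    have hk : `|pairing k (h *: delta_mx 0 i + x) - pairing k x| <= `|h| * (l1norm k).+1%:R.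
      rewrite pairingDr addrK pairing_dir normrM mulrC ler_wpM2l//.
      exact: le_coord_l1normS.
    by rewrite lerD// normrM ler_wpM2l// (le_trans _ hk)//;
      [exact: cos_lipschitz|exact: sin_lipschitz].
  - move=> nu; apply: le_trans (block_le _ _ _ _) _; exact: (weight_dcoef 0 i (a, b)).
  - move=> nu; rewrite /T /block.
    under eq_cvg do rewrite -sumrB mulr_sumr.
    apply: cvgr_sum => k /=.
    have hc : h^-1 * (cosp k (h *: delta_mx 0 i + x) - cosp k x) @[h --> 0^'] -->
        - (k 0 i)%:~R * sinp k x.
      have [h1 <-] := is_derive_cosp k i x; exact: h1.
    have hs : h^-1 * (sinp k (h *: delta_mx 0 i + x) - sinp k x) @[h --> 0^'] -->
        (k 0 i)%:~R * cosp k x.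
      have [h1 <-] := is_derive_sinp k i x; exact: h1.
    rewrite (_ : (k 0 i)%:~R * b k * cosp k x + - (k 0 i)%:~R * a k * sinp k x =
        a k * (- (k 0 i)%:~R * sinp k x) +
        b k * ((k 0 i)%:~R * cosp k x)); last by ring.
    rewrite (_ : (fun h : R => _) = (fun h : R =>
        a k * (h^-1 * (cosp k (h *: delta_mx 0 i + x) - cosp k x)) +
        b k * (h^-1 * (sinp k (h *: delta_mx 0 i + x) - sinp k x)))).
      by apply: cvgD; apply: cvgM => //; exact: cvg_cst.
    by apply/funext => h; ring.
have dT : derivable (wave_series a b : _ -> R^o) x (delta_mx 0 i).
  by apply/cvg_ex; eexists; rewrite /= TE; exact: cT.
split => //; rewrite /derive TE; exact/cvg_lim.
Qed.

Definition dcoefs (s : seq 'I_n) c := foldr dcoef c s.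

Lemma summable_dcoefs m s c : wave_summable (m + size s) c.1 c.2 ->
  wave_summable m (dcoefs s c).1 (dcoefs s c).2.
Proof.
elim: s m => [|i s IH] m /=; first by rewrite addn0.
by rewrite addnS => h; apply: summable_dcoef; exact: (IH m.+1).
Qed.

Lemma partials_wave_series s c : wave_summable (size s) c.1 c.2 ->
  partials s (wave_series c.1 c.2 : _ -> R^o) =
  wave_series (dcoefs s c).1 (dcoefs s c).2.
Proof.
elim: s => [//|i s IH] /= h; apply/funext => x.
rewrite IH; last exact: summable_le h.
have [|_ ->//] := @is_derive_wave_series i (dcoefs s c) x.
by apply: summable_dcoefs.
Qed.

Lemma torus_C_wave_series l c : wave_summable l c.1 c.2 ->
  torus_C l (wave_series c.1 c.2 : _ -> R^o).
Proof.
move=> h; split=> [|s sl]; first exact: periodic_wave_series.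
rewrite partials_wave_series; last exact: summable_le h.
split=> [|{}sl i x].
  apply: continuous_wave_series; apply: summable_dcoefs.
  by rewrite add0n; exact: summable_le h.
have [|//] := @is_derive_wave_series i (dcoefs s c) x.
by apply: summable_dcoefs; rewrite add1n; exact: summable_le h.
Qed.

Lemma tmeas_block a b nu : tmeas (block a b nu).
Proof. by apply: tmeas_continuous; exact: continuous_block. Qed.

Lemma fbounded_block a b nu : fbounded (block a b nu).
Proof. by exists (wave_weight 0 a b nu) => x; exact: block_le. Qed.

Lemma tint_block a b nu : tint (block a b nu).
Proof. by apply: tint_fbounded; [exact: tmeas_block|exact: fbounded_block]. Qed.

Lemma fbounded_wave_series a b : wave_summable 0 a b -> fbounded (wave_series a b).
Proof.
move=> h; apply: fbounded_periodic; first exact: continuous_wave_series.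
exact: periodic_wave_series.
Qed.

Lemma tmeas_wave_series a b : wave_summable 0 a b -> tmeas (wave_series a b).
Proof. by move=> h; apply: tmeas_continuous; exact: continuous_wave_series. Qed.

Lemma tint_wave_series a b : wave_summable 0 a b -> tint (wave_series a b).
Proof.
by move=> h; apply: tint_fbounded; [exact: tmeas_wave_series|exact: fbounded_wave_series].
Qed.

Lemma torus_integral_blockM a b nu (phi : 'rV[R]_n -> R) : tmeas phi -> fbounded phi ->
  torus_integral (fun x => block a b nu x * phi x) =
  \sum_(k <- S nu) (a k * torus_integral (fun x => cosp k x * phi x) +
                    b k * torus_integral (fun x => sinp k x * phi x)).
Proof.
move=> mp bp.
have ic k : tint (fun x => cosp k x * phi x) by apply: tintM => //; exact: tint_cosp.
have ins k : tint (fun x => sinp k x * phi x) by apply: tintM => //; exact: tint_sinp.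
have -> : (fun x => block a b nu x * phi x) = (fun x => \sum_(k <- S nu)
    (a k * (cosp k x * phi x) + b k * (sinp k x * phi x))).
  apply/funext => x; rewrite /block mulr_suml; apply: eq_bigr => k _; ring.
rewrite torus_integral_sum => [|k]; last by apply: tintD; exact: tintZ.
by apply: eq_bigr => k _; rewrite torus_integralD ?torus_integralZ//; exact: tintZ.
Qed.

(** The partial sums are dominated by the total weight, a constant. *)
Lemma cvg_torus_integral_wave_series a b (phi : 'rV[R]_n -> R) : wave_summable 0 a b ->
  tmeas phi -> fbounded phi ->
  series (fun nu => torus_integral (fun x => block a b nu x * phi x)) @ \oo -->
  torus_integral (fun x => wave_series a b x * phi x).
Proof.
move=> sab mp [M bp].
have bphi : fbounded phi by exists M.
pose W := limn (series (wave_weight 0 a b)).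
have [] := @torus_integral_dominated _ n
   (fun N x => series (fun nu => block a b nu x) N * phi x)
   (fun x => wave_series a b x * phi x) (fun=> W * M).
- move=> N; apply: tmeasM => //; apply: tmeas_continuous.
  move=> x; apply: (@cvgr_sum _ _ (nbhs x) (nbhs_filter x)) => nu.
  exact: continuous_block.
- by apply: tmeasM => //; exact: tmeas_wave_series.
- exact: tint_cst.
- apply: aeW => t; apply: cvgM; last exact: cvg_cst.
  exact: cvg_wave_series.
- apply: aeW => t N; rewrite normrM ler_pM//.
  apply: (@le_trans _ _ (series (wave_weight 0 a b) N)).
    rewrite /series/= (le_trans (ler_norm_sum _ _ _))//.
    by apply: ler_sum => nu _; exact: block_le.
  apply: nondecreasing_cvgn_le => //.
  by apply: nondecreasing_series => nu _ _; exact: weight_ge0.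
move=> _.
rewrite (_ : (fun N => torus_integral _) = series (fun nu =>
    torus_integral (fun x => block a b nu x * phi x)))//.
apply/funext => N; rewrite /series/= -torus_integral_sum => [|nu].
  by congr torus_integral; apply/funext => x; rewrite mulr_suml.
by apply: tintM => //; exact: tint_block.
Qed.

Lemma sum_level (a : 'rV[int]_n -> R) l nu :
  \sum_(k <- S nu) a k * (k == l)%:R = (lev l == nu)%:R * a l.
Proof.
rewrite -memS; case: (boolP (l \in S nu)) => lS.
  rewrite (bigD1_seq l)//= eqxx mulr1 mul1r big1 ?addr0// => k /negbTE ->.
  by rewrite mulr0.
rewrite mul0r big1_seq// => k /andP[_ kS].
by case: eqP => [kl|_]; rewrite ?mulr0//; move: lS; rewrite -kl kS.
Qed.

(** Orthogonality leaves finitely many nonzero levels (at most those of l and - l), so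
the series of integrals is eventually constant. *)
Lemma limn_series_level (F : nat -> R) (c : seq (nat * R)) :
  (forall nu, F nu = \sum_(p <- c) (p.1 == nu)%:R * p.2) ->
  series F @ \oo --> \sum_(p <- c) p.2.
Proof.
move=> FE.
have -> : series F = (fun N => \sum_(p <- c) \sum_(0 <= nu < N) (p.1 == nu)%:R * p.2).
  apply/funext => N; rewrite /series/= exchange_big/=.
  by apply: eq_bigr => nu _; rewrite FE.
apply: cvgr_sum => -[m r] /=.
apply: cvg_near_cst; near=> N.
have mN : (m < N)%N by near: N; exact: nbhs_infty_gt.
rewrite big_mkord (bigD1 (Ordinal mN))//= eqxx mul1r big1 ?addr0// => i.
rewrite -val_eqE/= => /negbTE im.
by rewrite [m == _]eq_sym im mul0r.
Unshelve. all: by end_near. Qed.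

Lemma torus_integral_wave_series_cosp a b l : wave_summable 0 a b ->
  torus_integral (fun x => wave_series a b x * cosp l x) = 2^-1 * (a l + a (- l)).
Proof.
move=> sab.
have c1 := cvg_torus_integral_wave_series sab (tmeas_cosp l) (fbounded_cosp l).
have c2 : series (fun nu => torus_integral (fun x => block a b nu x * cosp l x)) @ \oo -->
    \sum_(p <- [:: (lev (- l), 2^-1 * a (- l)); (lev l, 2^-1 * a l)]) p.2.
  apply: limn_series_level => nu.
  rewrite torus_integral_blockM; [|exact: tmeas_cosp|exact: fbounded_cosp].
  rewrite big_cons big_seq1/= ![_%:R * (2^-1 * _)]mulrCA -!sum_level -mulrDr -big_split/=.
  rewrite mulr_sumr; apply: eq_bigr => k _.
  by rewrite torus_integral_cosp2 torus_integral_sinp_cosp; ring.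
have := cvg_unique _ c1 c2.
by move=> ->//; rewrite big_cons big_seq1/=; ring.
Qed.

Lemma torus_integral_wave_series_sinp a b l : wave_summable 0 a b ->
  torus_integral (fun x => wave_series a b x * sinp l x) = 2^-1 * (b l - b (- l)).
Proof.
move=> sab.
have c1 := cvg_torus_integral_wave_series sab (tmeas_sinp l) (fbounded_sinp l).
have c2 : series (fun nu => torus_integral (fun x => block a b nu x * sinp l x)) @ \oo -->
    \sum_(p <- [:: (lev (- l), - 2^-1 * b (- l)); (lev l, 2^-1 * b l)]) p.2.
  apply: limn_series_level => nu.
  rewrite torus_integral_blockM; [|exact: tmeas_sinp|exact: fbounded_sinp].
  rewrite big_cons big_seq1/= ![_%:R * (_ * _)]mulrCA -!sum_level !mulr_sumr -big_split/=.
  apply: eq_bigr => k _.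
  have -> : torus_integral (fun x : 'rV[R]_n => cosp k x * sinp l x) = 0.
    rewrite -[RHS](torus_integral_sinp_cosp l k).
    by congr torus_integral; apply/funext => x; exact: mulrC.
  by rewrite torus_integral_sinp2; ring.
have := cvg_unique _ c1 c2.
by move=> ->//; rewrite big_cons big_seq1/=; ring.
Qed.
End wave_series.

(** * Counting lattice points in shells *)
Section lattice.
Context {n : nat}.

Definition box (N : nat) : seq 'rV[int]_n :=
  [seq \row_j ((f j : nat)%:Z - N%:Z) | f : {ffun 'I_n -> 'I_(N.*2.+1)}].

Lemma mem_box N k : (k \in box N) = [forall j, (`|k 0%R j| <= N)%N].
Proof.
apply/mapP/forallP => [[f _ ->] j|h].
  rewrite mxE; have := ltn_ord (f j); move: (nat_of_ord (f j)) => m.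
  rewrite -mul2n => ?; lia.
have lt j : (`|(k 0 j + N%:Z)%R| < N.*2.+1)%N by have := h j; lia.
exists [ffun j => Ordinal (lt j)]; first by rewrite mem_enum.
apply/rowP => j; rewrite !mxE ffunE /=; have := h j.
by move: (k 0 j) => z zN; lia.
Qed.

Lemma box_uniq N : uniq (box N).
Proof.
rewrite map_inj_uniq ?enum_uniq// => f g /rowP fg; apply/ffunP => j.
by have := fg j; rewrite !mxE => h; apply/val_inj => /=; lia.
Qed.

Lemma size_box N : size (box N) = ((N.*2.+1) ^ n)%N.
Proof. by rewrite size_map -cardE card_ffun !card_ord. Qed.

Lemma le_coord_l1normN (k : 'rV[int]_n) j : (`|k 0%R j| <= l1norm k)%N.
Proof. by rewrite /l1norm (bigD1 j)//= leq_addr. Qed.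

Lemma l1norm0 : l1norm (0 : 'rV[int]_n) = 0%N.
Proof. by rewrite /l1norm big1// => j _; rewrite mxE. Qed.

Lemma l1normN (k : 'rV[int]_n) : l1norm (- k) = l1norm k.
Proof. by apply: eq_bigr => j _; rewrite mxE abszN. Qed.

(** Level nu.+1 is the shell number nu; level 0 is reserved for the origin, which belongs
to no shell. *)
Definition level (b : nat) (k : 'rV[int]_n) : nat :=
  if k == 0 then 0%N else (up_log b (l1norm k)).+1.

Definition shell_seq (b nu : nat) : seq 'rV[int]_n :=
  [seq k <- box (b ^ nu.-1) | level b k == nu].

Lemma shell_seq_uniq b nu : uniq (shell_seq b nu).
Proof. exact/filter_uniq/box_uniq. Qed.

Lemma mem_shell_seq b nu k : (1 < b)%N -> (k \in shell_seq b nu) = (level b k == nu).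
Proof.
move=> b1; rewrite mem_filter; case: eqP => //= <-; rewrite mem_box.
apply/forallP => j; apply: leq_trans (le_coord_l1normN k j) _.
rewrite /level; case: eqP => [->|_]; first by rewrite l1norm0.
exact: up_logP.
Qed.

Lemma levelN b k : level b (- k) = level b k.
Proof. by rewrite /level oppr_eq0 l1normN. Qed.
End lattice.

Section shells.
Context {R : realType} {n : nat}.
Variable b : nat.
Hypothesis b1 : (1 < b)%N.

Lemma le_l1norm_shell nu (k : 'rV[int]_n) : level b k = nu.+1 -> (b ^ nu <= b * l1norm k)%N.
Proof.
rewrite /level; case: eqP => // /eqP k0 [<-].
have k1 := l1norm_ge1 k0.
case: (posnP (up_log b (l1norm k))) => [->|u0]; first by nia.
rewrite -(prednK u0) expnS leq_mul2l; apply/orP; right; apply/ltnW/up_log_gtn => //.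
by rewrite ltnNge; apply/negP => h; move: u0; rewrite lt0n up_log_eq0 h orbT.
Qed.

Let b0 : (0 : R) < b%:R. Proof. by rewrite ltr0n; lia. Qed.

Lemma shellE nu (k : 'rV[int]_n) : shell R b nu k <-> level b k = nu.+1.
Proof.
rewrite /level; split => [[h1 h2]|].
  have k0 : k != 0.
    by apply/eqP => k0; move: h1; rewrite k0 l1norm0 ltNge ltW ?exprz_gt0.
  rewrite (negbTE k0); congr _.+1; apply/eqP; rewrite eqn_leq up_log_min//=.
  case: nu h1 {h2} => // nu.
  rewrite -addn1 PoszD addrK -exprnP -natrX ltr_nat => h.
  rewrite addn1 ltnNge; apply/negP => h'.
  have := leq_trans (up_logP (l1norm k) b1) (leq_pexp2l (ltnW b1) h').
  by rewrite leqNgt h.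
case: eqP => // /eqP k0 [<-]; have k1 := l1norm_ge1 k0; split; last exact: up_logP.
case: (posnP (up_log b (l1norm k))) => [->|u0].
  by rewrite sub0r -invr_expz expr1z (lt_le_trans (y := 1)) ?invf_lt1 ?ltr1n ?ler1n.
rewrite -(prednK u0) -addn1 PoszD addrK -exprnP -natrX ltr_nat.
apply: up_log_gtn => //.
by rewrite ltnNge; apply/negP => h; move: u0; rewrite lt0n up_log_eq0 h orbT.
Qed.

Lemma esum_shell nu (F : 'rV[int]_n -> R) : (forall k, 0 <= F k) ->
  (\esum_(k in shell R b nu) (F k)%:E = (\sum_(k <- shell_seq b nu.+1) F k)%:E)%E.
Proof.
move=> F0.
have -> : shell R b nu = [set` @shell_seq n b nu.+1].
  apply/seteqP; split => k /=; rewrite mem_shell_seq//.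
    by move/shellE => ->.
  by move/eqP => h; apply/shellE.
rewrite esum_fset//; [|exact: finite_seq|by move=> k _; rewrite lee_fin].
by rewrite -fsbig_seq ?shell_seq_uniq// sumEFin.
Qed.

(** The shell has at most (3 b^nu)^n points, all of norm at least b^nu / b.  The bound does
not depend on nu: this is why a space defined by a sum over nu of square roots gains
half a dimension without any logarithmic loss. *)
Lemma shell_harmonic nu :
  \sum_(k <- @shell_seq n b nu.+1) (l1norm k)%:R ^- n <= (3 * b%:R) ^+ n :> R.
Proof.
have bn0 : (0 : R) < b%:R ^+ nu by exact: exprn_gt0.
apply: (@le_trans _ _ (\sum_(k <- @shell_seq n b nu.+1) (b%:R / b%:R ^+ nu) ^+ n)).
  rewrite big_seq [leRHS]big_seq; apply: ler_sum => k; rewrite mem_shell_seq// => /eqP kl.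
  have := le_l1norm_shell kl; rewrite -(ler_nat R) natrM natrX => h.
  have k0 : (0 : R) < (l1norm k)%:R.
    by rewrite -(pmulr_rgt0 _ b0) (lt_le_trans bn0).
  rewrite -exprVn; apply: lerXn2r.
  - by rewrite nnegrE invr_ge0 ltW.
  - by rewrite nnegrE divr_ge0// ltW.
  - by rewrite ler_pdivlMr// ler_pdivrMl// mulrC.
rewrite big_const_seq count_predT iter_addr_0 -[leLHS]mulr_natl.
have sz : (size (@shell_seq n b nu.+1) <= (3 * b ^ nu) ^ n)%N.
  apply: (@leq_trans (size (@box n (b ^ nu)))).
    rewrite size_filter; exact: count_size.
  rewrite size_box; case: (n) => // m; rewrite leq_exp2r//.
  have : (0 < b ^ nu)%N by rewrite expn_gt0; lia.
  by move: (b ^ nu)%N => B; lia.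
have {}sz : (size (@shell_seq n b nu.+1))%:R <= (3 * b%:R ^+ nu) ^+ n :> R.
  by rewrite -(natrX R b nu) -natrM -natrX ler_nat.
apply: (@le_trans _ _ ((3 * b%:R ^+ nu) ^+ n * (b%:R / b%:R ^+ nu) ^+ n)).
  by rewrite ler_wpM2r// exprn_ge0// divr_ge0 ?ltW.
rewrite -exprMn le_eqVlt; apply/orP; left; apply/eqP; congr (_ ^+ n).
by field; rewrite gt_eqF.
Qed.

End shells.

(** * Classical derivatives of elements of the space *)
Section fourier.
Context {R : realType}.

(** Stated with x^2 <= w y, so that the weights w and y need not be given as squares. *)
Lemma cauchy_schwarz_seq (I : eqType) (s : seq I) (x w y : I -> R) :
  (forall i, i \in s -> 0 <= w i /\ 0 <= y i /\ x i ^+ 2 <= w i * y i) ->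
  (\sum_(i <- s) x i) ^+ 2 <= (\sum_(i <- s) w i) * (\sum_(i <- s) y i).
Proof.
suff H : (forall i, i \in s -> 0 <= w i /\ 0 <= y i /\ x i ^+ 2 <= w i * y i) ->
   [/\ 0 <= \sum_(i <- s) w i, 0 <= \sum_(i <- s) y i &
     (\sum_(i <- s) x i) ^+ 2 <= (\sum_(i <- s) w i) * (\sum_(i <- s) y i)].
  by move=> /H[].
elim: s => [|i s IH] h; first by rewrite !big_nil expr0n mulr0.
have [|W0 Y0] := IH; first by move=> k ks; apply: h; rewrite inE ks orbT.
have [w0 [y0]] := h i (mem_head _ _).
rewrite !big_cons.
move: (\sum_(_ <- _) _) (\sum_(_ <- _) _) (\sum_(_ <- _) _) (w i) (y i) (x i) W0 Y0 w0 y0.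
move=> X Y W w' y' x' W0 Y0 w0 y0 xwy XWY; split; [lra|lra|].
have PQ : 2 * (x' * X) <= W * y' + w' * Y.
  rewrite (le_trans (ler_norm _))// -[leRHS]ger0_norm; last by rewrite addr_ge0 ?mulr_ge0.
  rewrite -ler_sqr ?nnegrE// !real_normK ?num_real//.
  have h1 : x' ^+ 2 * X ^+ 2 <= (w' * y') * (W * Y) by rewrite ler_pM ?sqr_ge0.
  have h2 : 0 <= (W * y' - w' * Y) ^+ 2 by exact: sqr_ge0.
  nra.
nra.
Qed.

Definition fcos n (f : 'rV[R]_n -> 'rV[R]_n) j k : R :=
  torus_integral (fun x => f x 0 j * cosp k x).
Definition fsin n (f : 'rV[R]_n -> 'rV[R]_n) j k : R :=
  torus_integral (fun x => f x 0 j * sinp k x).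

Lemma sqnormC_fourier n (f : 'rV[R]_n -> 'rV[R]_n) k :
  (forall j, tint (fun x => f x 0 j)) ->
  sqnormC (fourier_coef f k) = \sum_j (fcos f j k ^+ 2 + fsin f j k ^+ 2).
Proof.
move=> fi; apply: eq_bigr => j _.
rewrite mxE /torus_cintegral /= sqr_sqrtr ?addr_ge0 ?sqr_ge0//; congr (_ ^+ 2 + _).
  congr torus_integral; apply/funext => x.
  by rewrite /expi /= mul0r subr0 cosN.
rewrite -[RHS]sqrrN -[in RHS]mulN1r -torus_integralZ; last first.
  by apply: tintM => //; [exact: tmeas_sinp|exact: fbounded_sinp].
congr (_ ^+ 2); congr torus_integral; apply/funext => x.
by rewrite /expi /= mul0r addr0 sinN mulrN mulN1r.
Qed.

Lemma torus_Lp1_tint n (f : 'rV[R]_n -> 'rV[R]_n) j :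
  torus_Lp 1%E f -> tint (fun x => f x 0 j).
Proof. by move=> [_ h]; have /Lfun1_integrable := h j. Qed.

Lemma is_cvg_series_EFin (q : nat -> R) : (forall nu, 0 <= q nu) ->
  (\sum_(0 <= nu <oo) (q nu)%:E < +oo)%E -> cvgn (series q).
Proof.
move=> q0 h; apply: nondecreasing_is_cvgn.
  by apply: nondecreasing_series => nu _ _.
exists (fine (\sum_(0 <= nu <oo) (q nu)%:E)%E) => _ [N _ <-].
rewrite -lee_fin fineK; last first.
  by rewrite ge0_fin_numE//; apply: nneseries_ge0 => *; rewrite lee_fin.
rewrite /series/= -sumEFin.
by apply: nneseries_lim_ge => nu _ _; rewrite lee_fin.
Qed.

Lemma is_cvg_series_S (M : nat -> R) :
  cvgn (series (fun nu => M nu.+1)) -> cvgn (series M).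
Proof.
move=> h; apply/cvg_ex; exists (M 0%N + limn (series (fun nu => M nu.+1))).
rewrite -(cvg_shiftS (series M)).
rewrite (_ : [sequence _]_n = fun N => M 0%N + series (fun nu => M nu.+1) N).
  by apply: cvgD => //; exact: cvg_cst.
by apply/funext => N; rewrite /series/= big_nat_recl.
Qed.

Lemma cvg_row T (F : set_system T) (FF : Filter F) n (u : 'I_n -> T -> R)
    (a : 'I_n -> R) :
  (forall j, u j x @[x --> F] --> a j) ->
  (\row_j u j x : 'rV[R]_n) @[x --> F] --> \row_j a j.
Proof.
move=> cu; apply/cvgrPdist_le => /= e e0; near=> y.
rewrite [leLHS]/Num.Def.normr/= mx_normrE (bigmax_le _ (ltW e0))//= => i _.
rewrite !mxE/=; move: i; near: y; apply: filter_forall => /= i.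
exact: ((cvgrPdist_le _ _).1 (cu i.2)).
Unshelve. all: by end_near. Qed.

Lemma continuous_row n (u : 'I_n -> 'rV[R]_n -> R) :
  (forall j, continuous (u j)) -> continuous (fun x => \row_j u j x : 'rV[R]_n).
Proof. by move=> cu x; apply: (@cvg_row _ (nbhs x) (nbhs_filter x)) => j; exact: cu. Qed.

(** Iterated partial derivatives act componentwise. *)
Lemma torus_C_row n l (u : 'I_n -> 'rV[R]_n -> R) :
  (forall j, torus_C l (u j : _ -> R^o)) -> torus_C l (fun x => \row_j u j x : 'rV[R]_n).
Proof.
move=> cu.
have E s : (size s <= l)%N -> partials s (fun x => \row_j u j x : 'rV[R]_n) =
    (fun x => \row_j partials s (u j : _ -> R^o) x).
  elim: s => [//|i s IH] /= sl; apply/funext => x; rewrite IH; last exact: ltnW.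
  have d j y : derivable (partials s (u j : _ -> R^o)) y (delta_mx 0 i).
    by have [_ /(_ s (ltnW sl))[_ /(_ sl)]] := cu j; exact.
  rewrite derive_mx; last first.
    apply/derivable_mxP => i' j.
    rewrite (_ : (fun y => _) = partials s (u j : _ -> R^o)); first exact: d.
    by apply/funext => y; rewrite mxE.
  apply/rowP => j; rewrite [LHS]mxE [RHS]mxE.
  rewrite (_ : (fun y : 'rV[R]_n => _) = partials s (u j : _ -> R^o))//.
  by apply/funext => y; rewrite mxE.
split=> [k x|s sl].
  by apply/rowP => j; rewrite !mxE; have [-> _] := cu j.
rewrite E//; split=> [|{}sl i x].
  by apply: continuous_row => j; have [_ /(_ s sl)[]] := cu j.
apply/derivable_mxP => i' j.
rewrite (_ : (fun y => _) = partials s (u j : _ -> R^o)); last first.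
  by apply/funext => y; rewrite mxE.
by have [_ /(_ s (ltnW sl))[_ /(_ sl)]] := cu j; exact.
Qed.

Lemma torus_ae_forall n (P : 'I_n -> n.-tuple (measurableTypeR R) -> Prop) :
  (forall j, {ae torus_measure R n, forall t, P j t}) ->
  {ae torus_measure R n, forall t, forall j, P j t}.
Proof.
move=> aP.
exact: (@filter_forall _ _ _ _ (ae_filter_ringOfSetsType (torus_measure R n)) aP).
Qed.

Section classical_derivatives.
Variables (n b : nat) (tau : R).
Hypothesis b1 : (1 < b)%N.
Variable f : 'rV[R]_n -> 'rV[R]_n.
Hypothesis fL : Ltilde tau b f.

Let fi j : tint (fun x => f x 0 j).
Proof. by case: fL => h _; exact: torus_Lp1_tint. Qed.

Let Q nu := \sum_(k <- @shell_seq n b nu.+1)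
  sqnormC (fourier_coef f k) * (l1norm k)%:R `^ (2 * tau + 2).

Let sq_ge0 k : 0 <= sqnormC (fourier_coef f k).
Proof. by apply: sumr_ge0 => j _; exact: sqr_ge0. Qed.

Let Q_ge0 nu : 0 <= Q nu.
Proof. by apply: sumr_ge0 => k _; rewrite mulr_ge0// powR_ge0. Qed.

Let cvgQ : cvgn (series (fun nu => Num.sqrt (Q nu))).
Proof.
case: fL => _ /= h; apply: is_cvg_series_EFin; first by move=> nu; exact: sqrtr_ge0.
apply: le_lt_trans h; rewrite le_eqVlt; apply/orP; left; apply/eqP.
apply: eq_eseriesr => nu _.
rewrite esum_shell//; last by move=> k; rewrite mulr_ge0// powR_ge0.
by rewrite poweR_EFin -/(Q nu) powR12_sqrt.
Qed.

(** Cauchy-Schwarz on one shell with weights |k|^-n and |f_k|^2 |k|^(2 tau + 2): the first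
sum is bounded by shell_harmonic, and the square root of the second is the term of the
series that defines the space. *)
Lemma summable_fourier l j : l%:R <= tau - n%:R / 2 + 1 ->
  wave_summable (@shell_seq n b) l (fcos f j) (fsin f j).
Proof.
move=> lt; apply: is_cvg_series_S.
pose C := Num.sqrt ((3 * b%:R) ^+ n * (2 * 4 ^+ l) : R).
apply: (@is_cvg_series_dom _ _ (fun nu => C * Num.sqrt (Q nu))); last first.
  move=> nu; rewrite ger0_norm ?weight_ge0// -sqrtrM ?mulr_ge0 ?exprn_ge0//.
  rewrite -[leLHS]ger0_norm ?weight_ge0// -sqrtr_sqr ler_sqrt; last first.
    by rewrite !mulr_ge0 ?exprn_ge0.
  apply: (@le_trans _ _ ((\sum_(k <- @shell_seq n b nu.+1) (l1norm k)%:R ^- n) *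
     (\sum_(k <- @shell_seq n b nu.+1) (2 * 4 ^+ l) *
        (sqnormC (fourier_coef f k) * (l1norm k)%:R `^ (2 * tau + 2))))); last first.
    rewrite -mulr_sumr -/(Q nu) -[leRHS]mulrA; apply: ler_wpM2r.
      by rewrite !mulr_ge0 ?exprn_ge0.
    exact: shell_harmonic.
  apply: cauchy_schwarz_seq => k; rewrite mem_shell_seq// => /eqP kl.
  have k0 : k != 0 by apply/eqP => k0; move: kl; rewrite /level k0 eqxx.
  have k1 : (1 : R) <= (l1norm k)%:R by rewrite ler1n l1norm_ge1.
  have kp : (0 : R) < (l1norm k)%:R by rewrite ltr0n l1norm_ge1.
  split; first by rewrite invr_ge0 exprn_ge0.
  split; first by rewrite !mulr_ge0 ?exprn_ge0 ?powR_ge0.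
  set A := fcos f j k; set B := fsin f j k; set K := (l1norm k)%:R.
  have AB : (`|A| + `|B|) ^+ 2 <= 2 * sqnormC (fourier_coef f k).
    apply: (@le_trans _ _ (2 * (A ^+ 2 + B ^+ 2))).
      rewrite -(real_normK (num_real A)) -(real_normK (num_real B)).
      have := sqr_ge0 (`|A| - `|B|); nra.
    rewrite ler_wpM2l// sqnormC_fourier// (bigD1 j)//= lerDl.
    by apply: sumr_ge0 => i _; rewrite addr_ge0 ?sqr_ge0.
  have KK : (l1norm k).+1%:R ^+ l <= (2 * K) ^+ l.
    by apply: lerXn2r; rewrite ?nnegrE ?mulr_ge0 ?ler0n// -natr1 mulr2n mulrDl mul1r lerD2l.
  (* The only place where the order l of differentiability is limited: n + 2 l <= 2 tau + 2. *)
  have KKK : K ^+ n * K ^+ (l + l) <= K `^ (2 * tau + 2).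
    rewrite -exprD -(powR_mulrn _ (ltW kp)) ler_powR// !natrD.
    by move: lt; lra.
  rewrite exprMn.
  apply: (@le_trans _ _ ((2 * sqnormC (fourier_coef f k)) * ((2 * K) ^+ l) ^+ 2)).
    apply: ler_pM; rewrite ?sqr_ge0//; apply: lerXn2r => //; rewrite nnegrE ?exprn_ge0//.
    by rewrite mulr_ge0.
  rewrite -exprM exprMn mulnC exprM (_ : 2 ^+ 2 = 4 :> R); last by rewrite expr2; ring.
  rewrite mul2n -addnn.
  rewrite [leRHS](_ : _ = 2 * sqnormC (fourier_coef f k) * 4 ^+ l *
     (K ^- n * K `^ (2 * tau + 2))); last by ring.
  rewrite mulrA; apply: ler_wpM2l.
    by rewrite !mulr_ge0 ?exprn_ge0.
  by rewrite ler_pdivlMl// exprn_gt0.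
rewrite (_ : series _ = fun N => C * series (fun nu => Num.sqrt (Q nu)) N).
  by apply: is_cvgM => //; exact: is_cvg_cst.
by apply/funext => N; rewrite /series/= mulr_sumr.
Qed.

(** The wave series with the Fourier coefficients of f is of class C^l and has the same
coefficients as f, hence represents it almost everywhere. *)
Lemma Ltilde_classical : 0 <= tau - n%:R / 2 ->
  has_classical_derivatives (Num.truncn (tau - n%:R / 2) + 1) f.
Proof.
move=> t0; set l := (_ + 1)%N.
have lt : l%:R <= tau - n%:R / 2 + 1 by rewrite natrD lerD2r truncn_le.
pose u j := wave_series (@shell_seq n b) (fcos f j) (fsin f j).
have su j := @summable_fourier l j lt.
have s0 j := summable_le (leq0n l) (su j).
have mS nu k : (k \in shell_seq b nu) = (level b k == nu) := @mem_shell_seq n b nu k b1.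
exists (fun x => \row_j u j x); split.
  apply: torus_C_row => j.
  by have := @torus_C_wave_series R n (@shell_seq n b) l (fcos f j, fsin f j) (su j).
have : {ae torus_measure R n, forall t, forall j, f (tvec t) 0 j - u j (tvec t) = 0}.
  apply: torus_ae_forall => j.
  have ui : tint (u j) by exact: tint_wave_series.
  apply: (@orthogonal_ae0 _ _ (fun x => f x 0 j - u j x)).
  - exact: tintB.
  - move=> k; under eq_fun do rewrite mulrBl.
    rewrite torus_integralB.
    + rewrite (torus_integral_wave_series_cosp mS (@shell_seq_uniq n b) k (s0 j)).
      have -> : fcos f j (- k) = fcos f j k.
        by congr torus_integral; apply/funext => x; rewrite /cosp pairingNl cosN.
      by rewrite /fcos; field.
    + by apply: tintM => //; [exact: tmeas_cosp|exact: fbounded_cosp].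
    + by apply: tintM => //; [exact: tmeas_cosp|exact: fbounded_cosp].
  - move=> k; under eq_fun do rewrite mulrBl.
    rewrite torus_integralB.
    + rewrite (torus_integral_wave_series_sinp mS (@shell_seq_uniq n b) k (s0 j)).
      have -> : fsin f j (- k) = - fsin f j k.
        rewrite -mulN1r -torus_integralZ; last first.
          by apply: tintM => //; [exact: tmeas_sinp|exact: fbounded_sinp].
        congr torus_integral; apply/funext => x.
        by rewrite /sinp pairingNl sinN mulrN mulN1r.
      by rewrite /fsin; field.
    + by apply: tintM => //; [exact: tmeas_sinp|exact: fbounded_sinp].
    + by apply: tintM => //; [exact: tmeas_sinp|exact: fbounded_sinp].
apply: torus_aeS => t h; apply/rowP => j; rewrite mxE.
by apply/eqP; rewrite -subr_eq0 h.
Qed.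

End classical_derivatives.
End fourier.

(** * Power-law decay over shells *)
Section decay.
Context {R : realType} {n : nat}.
Variable b : nat.
Hypothesis b1 : (1 < b)%N.

Let b0 : (0 : R) < b%:R. Proof. by rewrite ltr0n; lia. Qed.

Lemma level_gt0 (k : 'rV[int]_n) nu : level b k = nu.+1 -> k != 0.
Proof. by rewrite /level; case: eqP. Qed.

(** Compared with shell_harmonic, the extra factor |k|^-e is at most (b^nu / b)^-e on the
shell, so the shell sums decay geometrically. *)
Lemma shell_decay (e : R) nu : 0 <= e ->
  \sum_(k <- @shell_seq n b nu.+1) (l1norm k)%:R `^ (- (n%:R + e)) <=
  (3 * b%:R) ^+ n * b%:R `^ e * (b%:R `^ (- e)) ^+ nu :> R.
Proof.
move=> e0.
rewrite -mulrA; apply: (@le_trans _ _ (\sum_(k <- @shell_seq n b nu.+1)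
   (l1norm k)%:R ^- n * (b%:R `^ e * (b%:R `^ (- e)) ^+ nu))).
  rewrite big_seq [leRHS]big_seq; apply: ler_sum => k; rewrite mem_shell_seq// => /eqP kl.
  have kp : (0 : R) < (l1norm k)%:R by rewrite ltr0n l1norm_ge1// (level_gt0 kl).
  rewrite opprD powRD; last by rewrite (gt_eqF kp) implybT.
  rewrite (powRN _ n%:R) powR_mulrn ?ler0n//; apply: ler_wpM2l; first by rewrite invr_ge0 exprn_ge0.
  have := le_l1norm_shell b1 kl; rewrite -(ler_nat R) natrM natrX => h.
  rewrite -powR_mulrn ?powR_ge0// -powRrM -powRD; last by rewrite (gt_eqF b0) implybT.
  have -> : e + - e * nu%:R = - ((nu%:R - 1) * e) by ring.
  rewrite !(powRN _ (_ * _)) powRN lef_pV2 ?posrE ?powR_gt0//.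
  rewrite powRrM; apply: ge0_ler_powR; rewrite ?nnegrE ?powR_ge0 ?ler0n//.
  rewrite powRD ?(gt_eqF b0) ?implybT// powR_mulrn ?(ltW b0)// powRN powRr1 ?(ltW b0)//.
  by rewrite ler_pdivrMr// mulrC.
rewrite -mulr_suml; apply: ler_wpM2r; last exact: shell_harmonic.
by rewrite mulr_ge0 ?exprn_ge0 ?powR_ge0.
Qed.

Lemma is_cvg_geometric_dom (M : nat -> R) (C r : R) :
  (forall nu, 0 <= M nu <= C * r ^+ nu) -> 0 <= r < 1 -> cvgn (series M).
Proof.
move=> h /andP[r0 r1].
apply: (@is_cvg_series_dom _ _ (geometric C r)).
  by apply: is_cvg_geometric_series; rewrite ger0_norm.
by move=> nu; have /andP[? ?] := h nu; rewrite ger0_norm.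
Qed.

Lemma powR_baseN_lt1 (e : R) : 0 < e -> 0 <= b%:R `^ (- e) < 1.
Proof.
move=> e0; rewrite powR_ge0/= powRN invf_lt1 ?powR_gt0//.
have h : (1 : R) `^ e < b%:R `^ e.
  by apply: gt0_ltr_powR; rewrite ?nnegrE ?ler0n ?ler01 ?ltr1n.
by move: h; rewrite powR1.
Qed.

(** Sums over lattice boxes are compared through inclusion of their index sequences. *)
Lemma sumr_le_subseq (I : eqType) (s1 s2 : seq I) (P : pred I) (F : I -> R) :
  uniq s1 -> uniq s2 -> (forall i, i \in s1 -> i \in s2 /\ P i) ->
  (forall i, 0 <= F i) -> \sum_(i <- s1) F i <= \sum_(i <- s2 | P i) F i.
Proof.
move=> u1 u2 s12 F0.
rewrite (bigID (mem s1) P)/= -[leLHS]addr0 lerD//; last exact: sumr_ge0.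
rewrite -[leRHS]big_filter le_eqVlt; apply/orP; left; apply/eqP; apply: perm_big.
apply: uniq_perm => //; first exact: filter_uniq.
move=> i; rewrite mem_filter; apply/idP/idP => [is1|/andP[/andP[]]//].
by have [-> ->] := s12 i is1; rewrite is1.
Qed.
End decay.

(** * Divergence of the harmonic sum on a cone *)
Section harmonic.
Context {R : realType} {n : nat} (i0 : 'I_n).

(** Here the coordinate i0 carries at least half of the norm, so that powers of k_i0 are
comparable to powers of |k|. *)
Definition cone (k : 'rV[int]_n) : bool := (k != 0) && ((l1norm k)%:Z <= 2 * k 0 i0).

(** With q = n 2^mu, the 2^(mu n) points q e_i0 + f with 0 <= f_j < 2^mu lie in the cone and
have norm in [q, 2q[; together they contribute at least 2^(mu n) (2q)^-n = (2n)^-n.  The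
ranges [q, 2q[ for successive mu are disjoint, so each mu adds this same amount. *)
Lemma harmonic_cone N mu : (n * 2 ^ mu <= N)%N ->
  mu%:R * (2 * n%:R) ^- n <=
  \sum_(k <- @box n N | cone k && (l1norm k < n * 2 ^ mu)%N) (l1norm k)%:R ^- n :> R.
Proof.
have n0 : (0 < n)%N by case: (n) i0 => // -[].
elim: mu => [|mu IH] hN.
  by rewrite mul0r sumr_ge0// => k _; rewrite invr_ge0 exprn_ge0.
pose q := (n * 2 ^ mu)%N.
have q2 : (n * 2 ^ mu.+1 = q + q)%N by rewrite expnS /q; lia.
rewrite (bigID (fun k => l1norm k < q)%N)/= -natr1 mulrDl mul1r lerD//.
  rewrite (eq_bigl (fun k => cone k && (l1norm k < n * 2 ^ mu)%N)).
    by apply: IH; rewrite (leq_trans _ hN)// leq_mul2l leq_exp2l// leqnSn orbT.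
  move=> k; rewrite -andbA; congr (_ && _).
  rewrite q2 -/q; apply/andP/idP => [[]//|h]; split => //; lia.
pose g (f : {ffun 'I_n -> 'I_(2 ^ mu)}) : 'rV[int]_n :=
  \row_j ((f j : nat)%:Z + ((j == i0) * q)%N%:Z).
have gi : injective g.
  move=> f f' /rowP fg; apply/ffunP => j; have := fg j; rewrite !mxE => /addIr [] h.
  exact/val_inj.
have l1g f : l1norm (g f) = (\sum_j f j + q)%N.
  rewrite /l1norm; under eq_bigr do rewrite mxE -PoszD absz_nat.
  rewrite big_split/=; congr (_ + _)%N.
  by rewrite (bigD1 i0)//= eqxx mul1n big1 ?addn0// => j /negbTE ->; rewrite mul0n.
have sumf (f : {ffun 'I_n -> 'I_(2 ^ mu)}) : (\sum_j f j < q)%N.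
  have : (\sum_j (f j).+1 <= \sum_(j < n) 2 ^ mu)%N by apply: leq_sum => j _; exact: ltn_ord.
  rewrite sum_nat_const card_ord -/q; apply: leq_trans.
  rewrite (bigD1 i0)//= [in X in (_ <= X)%N](bigD1 i0)//= -addSn leq_add2l.
  by apply: leq_sum => j _; exact: leqnSn.
apply: (@le_trans _ _ (\sum_(k <- [seq g f | f : {ffun 'I_n -> 'I_(2 ^ mu)}]) (l1norm k)%:R ^- n)); last first.
  apply: sumr_le_subseq.
  - by rewrite map_inj_uniq ?enum_uniq.
  - exact: box_uniq.
  - move=> _ /mapP[f _ ->].
    have h1 := l1g f; have h2 := sumf f.
    have q0 : (0 < q)%N by rewrite muln_gt0 n0 expn_gt0.
    split.
      rewrite mem_box; apply/forallP => j; apply: leq_trans (le_coord_l1normN _ _) _.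
      by rewrite h1 (leq_trans _ hN)// q2 leq_add2r ltnW.
    rewrite h1 q2 ltn_add2r h2 -leqNgt leq_addl !andbT.
    apply/andP; split.
      by apply/eqP => g0; move: h1; rewrite g0 l1norm0; lia.
    rewrite h1 mxE eqxx mul1n; lia.
  - by move=> k; rewrite invr_ge0 exprn_ge0.
apply: (@le_trans _ _ (\sum_(k <- [seq g f | f : {ffun 'I_n -> 'I_(2 ^ mu)}]) (q + q)%:R ^- n)).
  rewrite big_const_seq count_predT iter_addr_0 size_map -cardE card_ffun !card_ord.
  rewrite -[leRHS]mulr_natl natrX -exprVn -[in leRHS]exprVn -exprMn.
  apply: lerXn2r; rewrite ?nnegrE ?mulr_ge0 ?invr_ge0 ?mulr_ge0 ?ler0n//.
  rewrite natrD /q natrM natrX -mulr2n -mulr_natl le_eqVlt; apply/orP; left; apply/eqP.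
  have : (n%:R : R) != 0 by rewrite pnatr_eq0 -lt0n.
  have : (2 ^+ mu : R) != 0 by rewrite expf_neq0.
  by move=> ? ?; field; apply/andP; split.
rewrite big_seq [leRHS]big_seq; apply: ler_sum => _ /mapP[f _ ->].
have h2 := sumf f.
have q0 : (0 < q)%N by rewrite muln_gt0 n0 expn_gt0.
rewrite -!exprVn; apply: lerXn2r; rewrite ?nnegrE ?invr_ge0 ?ler0n// l1g.
rewrite lef_pV2 ?posrE ?ltr0n ?ler_nat; lia.
Qed.

Lemma harmonic_cone_unbounded (K : R) :
  exists N, K <= \sum_(k <- @box n N | cone k) (l1norm k)%:R ^- n.
Proof.
have n0 : (0 < n)%N by case: (n) i0 => // -[].
pose mu := (Num.truncn (K * (2 * n%:R) ^+ n)).+1.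
exists (n * 2 ^ mu)%N.
have c0 : (0 : R) < (2 * n%:R) ^+ n by rewrite exprn_gt0// mulr_gt0// ltr0n.
apply: (@le_trans _ _ (mu%:R * (2 * n%:R) ^- n)).
  by rewrite ler_pdivlMr// ltW// truncnS_gt.
apply: le_trans (harmonic_cone (leqnn _)) _.
rewrite [leRHS](bigID (fun k => l1norm k < n * 2 ^ mu)%N)/= lerDl.
by apply: sumr_ge0 => k _; rewrite invr_ge0 exprn_ge0.
Qed.

End harmonic.

(** * The power-law field *)
Section power_series.
Context {R : realType} {n : nat} (i0 : 'I_n).
Variables (b : nat) (p : R).
Hypothesis b1 : (1 < b)%N.

Definition ampl (k : 'rV[int]_n) : R := (l1norm k)%:R `^ (- p).
(** The sine coefficient carries the sign of k_i0: after an odd number of derivatives in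
direction i0 the cosine coefficients come from the sines, and this sign makes them of
constant sign. *)
Definition sampl (k : 'rV[int]_n) : R := Num.sg (k 0 i0)%:~R * ampl k.

Lemma ampl_ge0 k : 0 <= ampl k.
Proof. exact: powR_ge0. Qed.

Lemma amplN k : ampl (- k) = ampl k.
Proof. by rewrite /ampl l1normN. Qed.

Lemma samplN k : sampl (- k) = - sampl k.
Proof. by rewrite /sampl amplN mxE mulrNz sgrN mulNr. Qed.

Lemma sampl_le k : `|sampl k| <= ampl k.
Proof.
by rewrite /sampl normrM normr_sg ger0_norm ?ampl_ge0// ler_piMl ?ampl_ge0//; case: eqP.
Qed.

Lemma is_cvg_shell_powR (F : nat -> R) (C e : R) : 0 < e ->
  (forall nu, 0 <= F nu.+1 <= C * \sum_(k <- @shell_seq n b nu.+1) (l1norm k)%:R `^ (- (n%:R + e))) ->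
  0 <= C -> cvgn (series F).
Proof.
move=> e0 h C0; apply: is_cvg_series_S.
apply: (@is_cvg_geometric_dom _ _ (C * ((3 * b%:R) ^+ n * b%:R `^ e)) (b%:R `^ (- e))).
  move=> nu; have /andP[-> h2] := h nu.
  by rewrite (le_trans h2)//= -mulrA ler_wpM2l// shell_decay// ltW.
exact: powR_baseN_lt1.
Qed.

Lemma wave_summable_power : n%:R < p ->
  wave_summable (@shell_seq n b) 0 ampl sampl.
Proof.
move=> np; apply: (@is_cvg_shell_powR _ 2 (p - n%:R)); rewrite ?subr_gt0// => nu.
rewrite weight_ge0/= mulr_sumr; apply: ler_sum => k _.
rewrite subrKC expr0 mulr1 mulr2n mulrDl !mul1r -/(ampl k).
by rewrite lerD// ?sampl_le// ger0_norm ?ampl_ge0.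
Qed.

Hypothesis np : n%:R < p.
Definition power_wave : 'rV[R]_n -> R := wave_series (@shell_seq n b) ampl sampl.
Definition power_field (x : 'rV[R]_n) : 'rV[R]_n := \row_j power_wave x.

Let mS nu (k : 'rV[int]_n) : (k \in shell_seq b nu) = (level b k == nu).
Proof. exact: mem_shell_seq. Qed.

Lemma power_wave_cosp l : torus_integral (fun x => power_wave x * cosp l x) = ampl l.
Proof.
rewrite (torus_integral_wave_series_cosp mS (@shell_seq_uniq n b) l (wave_summable_power np)).
by rewrite amplN; field.
Qed.

Lemma power_wave_sinp l : torus_integral (fun x => power_wave x * sinp l x) = sampl l.
Proof.
rewrite (torus_integral_wave_series_sinp mS (@shell_seq_uniq n b) l (wave_summable_power np)).
by rewrite samplN; field.
Qed.

Lemma tint_power_wave : tint power_wave.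
Proof. exact: tint_wave_series (wave_summable_power np). Qed.

Lemma power_field_coord j : (fun x => power_field x 0 j) = power_wave.
Proof. by apply/funext => x; rewrite mxE. Qed.

Lemma is_cvg_nneseries_real (q : nat -> R) : (forall nu, 0 <= q nu) ->
  cvgn (series q) -> (\sum_(0 <= nu <oo) (q nu)%:E < +oo)%E.
Proof.
move=> q0 cq.
rewrite (_ : (fun N : nat => _) = EFin \o series q).
  by rewrite EFin_lim// ltry.
by apply/funext => N; rewrite /= /series/= sumEFin.
Qed.

(** The shell sums of |f_k|^2 |k|^(2 tau + 2) decay like b^(- e nu) with
e = 2 p - (2 tau + 2) - n > 0, and so do, with half the rate, their square roots. *)
Lemma Ltilde_power_field (tau : R) : tau + 1 + n%:R / 2 < p ->
  Ltilde tau b power_field.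
Proof.
move=> tp; split.
  split=> [k x|j].
    by apply/rowP => j; rewrite !mxE /power_wave periodic_wave_series.
  apply/Lfun1_integrable.
  have := tint_power_wave; rewrite /tint; congr (_.-integrable _ _).
  by apply/funext => t /=; rewrite mxE.
pose Q nu := \sum_(k <- @shell_seq n b nu.+1)
  sqnormC (fourier_coef power_field k) * (l1norm k)%:R `^ (2 * tau + 2).
have Q0 nu : 0 <= Q nu.
  by apply: sumr_ge0 => k _; rewrite mulr_ge0 ?powR_ge0//; apply: sumr_ge0 => j _; exact: sqr_ge0.
rewrite /= (eq_eseriesr (g := fun nu => (Num.sqrt (Q nu))%:E)); last first.
  move=> nu _; rewrite esum_shell// ?poweR_EFin ?powR12_sqrt//; first exact: Q0.
  by move=> k; rewrite mulr_ge0 ?powR_ge0//; apply: sumr_ge0 => j _; exact: sqr_ge0.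
apply: is_cvg_nneseries_real => [nu|]; first exact: sqrtr_ge0.
pose e := 2 * p - (2 * tau + 2) - n%:R.
have e0 : 0 < e by move: tp; rewrite /e; lra.
have fi j : tint (fun x => power_field x 0 j) by rewrite power_field_coord; exact: tint_power_wave.
have sqE k : sqnormC (fourier_coef power_field k) <= n%:R * 2 * ampl k ^+ 2.
  rewrite sqnormC_fourier//.
  apply: (@le_trans _ _ (\sum_(j < n) 2 * ampl k ^+ 2)).
    apply: ler_sum => j _; rewrite /fcos /fsin.
    have -> : (fun x => power_field x 0 j * cosp k x) = (fun x => power_wave x * cosp k x).
      by apply/funext => x; rewrite mxE.
    have -> : (fun x => power_field x 0 j * sinp k x) = (fun x => power_wave x * sinp k x).
      by apply/funext => x; rewrite mxE.
    rewrite power_wave_cosp power_wave_sinp mulr2n mulrDl mul1r lerD2l.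
    rewrite -(real_normK (num_real (sampl k))) lerXn2r// ?nnegrE ?ampl_ge0//.
    exact: sampl_le.
  by rewrite sumr_const card_ord -[leLHS]mulr_natl mulrA.
have QC nu : Q nu <= n%:R * 2 * ((3 * b%:R) ^+ n * b%:R `^ e * (b%:R `^ (- e)) ^+ nu).
  apply: (@le_trans _ _ (n%:R * 2 * \sum_(k <- @shell_seq n b nu.+1)
      (l1norm k)%:R `^ (- (n%:R + e)))); last first.
    by apply: ler_wpM2l; [rewrite mulr_ge0 ?ler0n|apply: shell_decay => //; exact: ltW].
  rewrite mulr_sumr /Q big_seq [leRHS]big_seq; apply: ler_sum => k; rewrite mS => /eqP kl.
  have kp : (0 : R) < (l1norm k)%:R by rewrite ltr0n l1norm_ge1// (level_gt0 kl).
  apply: (@le_trans _ _ (n%:R * 2 * ampl k ^+ 2 * (l1norm k)%:R `^ (2 * tau + 2))).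
    by rewrite ler_wpM2r ?powR_ge0.
  rewrite -mulrA ler_wpM2l ?mulr_ge0 ?ler0n// /ampl.
  rewrite -powR_mulrn ?powR_ge0// -powRrM -powRD ?(gt_eqF kp) ?implybT//.
  by rewrite le_eqVlt; apply/orP; left; apply/eqP; congr (_ `^ _); rewrite /e; ring.
set r := b%:R `^ (- e) in QC.
have /andP[r0 r1] : 0 <= r < 1 by exact: powR_baseN_lt1.
pose C := n%:R * 2 * ((3 * b%:R) ^+ n * b%:R `^ e).
have C0 : 0 <= C by rewrite !mulr_ge0 ?exprn_ge0 ?powR_ge0 ?mulr_ge0 ?ler0n.
apply: (@is_cvg_geometric_dom _ _ (Num.sqrt C) (Num.sqrt r)).
  move=> nu; rewrite sqrtr_ge0/=.
  apply: (@le_trans _ _ (Num.sqrt (C * r ^+ nu))).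
    rewrite ler_sqrt ?mulr_ge0 ?exprn_ge0//; apply: le_trans (QC nu) _.
    by rewrite /C le_eqVlt; apply/orP; left; apply/eqP; ring.
  rewrite sqrtrM// -{1}(sqr_sqrtr r0) -exprM mulnC exprM sqrtr_sqr ger0_norm//.
by rewrite sqrtr_ge0/= -[ltRHS]sqrtr1 ltr_sqrt.
Qed.

End power_series.

(** * Integration by parts against trigonometric sums *)
Section trigsum.
Context {R : realType} {n : nat}.
Implicit Types (D : seq 'rV[int]_n) (c : ('rV[int]_n -> R) * ('rV[int]_n -> R)).

Definition trigsum D c (x : 'rV[R]_n) : R :=
  \sum_(k <- D) (c.1 k * cosp k x + c.2 k * sinp k x).

Lemma continuous_trigsum D c : continuous (trigsum D c).
Proof. exact: (@continuous_block R n (fun _ => D) c.1 c.2 0%N). Qed.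

Lemma periodic_trigsum D c : torus_periodic (trigsum D c).
Proof. exact: (@periodic_block R n (fun _ => D) c.1 c.2 0%N). Qed.

Lemma is_derive_trigsum D c i (x : 'rV[R]_n) :
  is_derive x (delta_mx 0 i) (trigsum D c : _ -> R^o) (trigsum D (dcoef i c) x).
Proof.
elim: D => [|k D IH].
  rewrite (_ : trigsum [::] c = cst 0); last by apply/funext => y; rewrite /trigsum big_nil.
  by rewrite /trigsum big_nil; exact: is_derive_cst.
rewrite (_ : trigsum (k :: D) c = (c.1 k *: (cosp k : _ -> R^o) + c.2 k *: (sinp k : _ -> R^o))
   + (trigsum D c : _ -> R^o)); last first.
  by apply/funext => y; rewrite /trigsum big_cons.
have h1 := is_derive_cosp k i x; have h2 := is_derive_sinp k i x.
apply: (is_derive_eq (is_deriveD (is_deriveD (is_deriveZ (c.1 k) h1)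
  (is_deriveZ (c.2 k) h2)) IH)).
rewrite /trigsum big_cons; congr (_ + _).
by rewrite /= /GRing.scale/=; ring.
Qed.

Lemma derive_trigsum D c i :
  'D_(delta_mx 0 i) (trigsum D c : _ -> R^o) = trigsum D (dcoef i c).
Proof. by apply/funext => x; have [] := is_derive_trigsum D c i x. Qed.

Lemma partials_trigsum D c s :
  partials s (trigsum D c : _ -> R^o) = trigsum D (dcoefs s c).
Proof.
elim: s => [//|i s IH] /=; rewrite IH.
exact: derive_trigsum.
Qed.

Lemma torus_Cinfty_trigsum D c : torus_Cinfty (trigsum D c : _ -> R^o).
Proof.
move=> l; split=> [|s _]; first exact: periodic_trigsum.
rewrite partials_trigsum; split=> [|_ i x]; first exact: continuous_trigsum.
by have [] := is_derive_trigsum D (dcoefs s c) i x.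
Qed.

Lemma tmeas_trigsum D c : tmeas (trigsum D c).
Proof. by apply: tmeas_continuous; exact: continuous_trigsum. Qed.

Lemma fbounded_trigsum D c : fbounded (trigsum D c).
Proof.
by apply: fbounded_periodic; [exact: continuous_trigsum|exact: periodic_trigsum].
Qed.

Lemma tint_trigsum D c : tint (trigsum D c).
Proof. by apply: tint_fbounded; [exact: tmeas_trigsum|exact: fbounded_trigsum]. Qed.

Lemma torus_integral_by_parts D c i (psi : 'rV[R]_n -> R^o) :
  torus_periodic psi -> continuous psi ->
  (forall x, derivable psi x (delta_mx 0 i)) -> continuous ('D_(delta_mx 0 i) psi) ->
  torus_integral (fun x => trigsum D c x * 'D_(delta_mx 0 i) psi x) =
  - torus_integral (fun x => trigsum D (dcoef i c) x * psi x).
Proof.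
move=> pp cp dp cdp.
have bm : tmeas psi /\ fbounded psi.
  by split; [exact: tmeas_continuous|exact: fbounded_periodic].
have bd : tmeas ('D_(delta_mx 0 i) psi) /\ fbounded ('D_(delta_mx 0 i) psi).
  split; [exact: tmeas_continuous|apply: fbounded_periodic => //].
  exact: torus_periodic_derive.
pose w : 'rV[R]_n -> R^o := (trigsum D c : _ -> R^o) * psi.
have dw x : is_derive x (delta_mx 0 i) w
   (trigsum D c x * 'D_(delta_mx 0 i) psi x + trigsum D (dcoef i c) x * psi x).
  have h1 := is_derive_trigsum D c i x.
  have h2 : is_derive x (delta_mx 0 i) psi ('D_(delta_mx 0 i) psi x) by split.
  apply: (is_derive_eq (is_deriveM h1 h2)); rewrite /GRing.scale/=; ring.
have Dw : 'D_(delta_mx 0 i) w = (fun x => trigsum D c x * 'D_(delta_mx 0 i) psi x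
     + trigsum D (dcoef i c) x * psi x).
  by apply/funext => x; have [] := dw x.
have := @torus_integral_derive0 R n i w.
rewrite Dw torus_integralD; first last.
- by apply: tintM; [exact: tint_trigsum|exact: bm.1|exact: bm.2].
- by apply: tintM; [exact: tint_trigsum|exact: bd.1|exact: bd.2].
move=> H; apply/eqP; rewrite -subr_eq0 opprK; apply/eqP; apply: H.
- by move=> k x; rewrite /w /= !fctE pp periodic_trigsum.
- by move=> x; have [] := dw x.
- by apply: continuous_addr; apply: continuous_mulr => //; exact: continuous_trigsum.
Qed.

(** The derivatives are moved to the other factor one at a time, the outermost first: the
coefficients are accumulated in the order opposite to that of dcoefs. *)
Definition dcoefl c (s : seq 'I_n) := foldl (fun c i => dcoef i c) c s.

Lemma torus_periodic_partials s (phi : 'rV[R]_n -> R^o) :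
  torus_periodic phi -> torus_periodic (partials s phi).
Proof. by move=> pp; elim: s => [//|i s IH] /=; exact: torus_periodic_derive. Qed.

Lemma torus_integral_partials D c s (phi : 'rV[R]_n -> R^o) : torus_Cinfty phi ->
  torus_integral (fun x => trigsum D c x * partials s phi x) =
  (-1) ^+ size s * torus_integral (fun x => trigsum D (dcoefl c s) x * phi x).
Proof.
move=> sp; elim: s c => [|i s IH] c /=; first by rewrite expr0 mul1r.
have [pp h] := sp (size s).+1.
have [cs] := h s (leqnSn _); move=> /(_ (leqnn _)) ds.
have [cis _] := h (i :: s) (leqnn _).
rewrite torus_integral_by_parts//; last exact: torus_periodic_partials.
by rewrite IH exprS mulN1r mulNr.
Qed.

End trigsum.

(** * Square integrable sums of series with geometric decay *)
Section L2_series.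
Context {R : realType} {n : nat}.
Local Notation mu := (torus_measure R n).

Lemma Lfun2_tint (g : 'rV[R]_n -> R) : tmeas g -> tint (fun x => g x ^+ 2) ->
  (fun t => g (tvec t)) \in Lfun mu 2%:E.
Proof.
move=> mg ig; rewrite inE; apply/andP; split; rewrite inE//=.
rewrite /finite_norm unlock /Lnorm poweR_lty//.
rewrite (eq_integral (fun t => (g (tvec t) ^+ 2)%:E)).
  exact: integrable_lty.
by move=> t _; rewrite /= powR_mulrn// real_normK ?num_real.
Qed.

Lemma geometric_sum_le (s : R) N : 0 < s < 1 -> \sum_(0 <= i < N) s ^+ i <= (1 - s)^-1.
Proof.
move=> /andP[s0 s1]; have := @geometric_le_lim R N 1 s ler01 s0.
rewrite ger0_norm ?(ltW s0)// div1r => /(_ s1).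
by rewrite /series/=; under eq_bigr do rewrite mul1r.
Qed.

Lemma tmeas_sum I (r : seq I) (F : I -> 'rV[R]_n -> R) :
  (forall i, tmeas (F i)) -> tmeas (fun x => \sum_(i <- r) F i x).
Proof.
move=> mF; elim: r => [|i r IH].
  by under eq_fun do rewrite big_nil; exact: tmeas_cst.
by under eq_fun do rewrite big_cons; exact: (tmeasD (mF i) IH).
Qed.

Variables (h : nat -> 'rV[R]_n -> R) (C s : R).
Hypothesis s01 : 0 < s < 1.
Hypothesis hm : forall nu, tmeas (h nu).
Hypothesis hb : forall nu, fbounded (h nu).
Hypothesis hp : forall nu, torus_periodic (h nu).
Hypothesis hC : forall nu, torus_integral (fun x => h nu x ^+ 2) <= C * (s ^+ nu) ^+ 2.

Let s0 : 0 < s. Proof. by case/andP: s01. Qed.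
Let s1 : s < 1. Proof. by case/andP: s01. Qed.

(** For L^2 norms of order s^nu, the sum of s^-nu h_nu^2 is integrable; where it is finite,
Cauchy-Schwarz against the geometric series bounds the sum of the |h_nu|.  A single
majorant thus gives almost everywhere convergence, square integrability of the sum and
the domination that integration term by term requires. *)
Definition sqmaj (x : 'rV[R]_n) : \bar R :=
  (\sum_(0 <= nu <oo) (s ^- nu * h nu x ^+ 2)%:E)%E.

Lemma sqmaj_term_ge0 nu x : 0 <= s ^- nu * h nu x ^+ 2.
Proof. by rewrite mulr_ge0 ?sqr_ge0// invr_ge0 exprn_ge0// ltW. Qed.

Lemma sqmaj_ge0 x : (0 <= sqmaj x)%E.
Proof. by apply: nneseries_ge0 => nu _ _; rewrite lee_fin sqmaj_term_ge0. Qed.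

Lemma tmeas_sqmaj_term nu : tmeas (fun x => s ^- nu * h nu x ^+ 2).
Proof.
apply: tmeasM; first exact: tmeas_cst.
by under eq_fun do rewrite expr2; exact: tmeasM.
Qed.

Lemma measurable_sqmaj : measurable_fun setT (fun t => sqmaj (tvec t)).
Proof.
apply: ge0_emeasurable_sum.
  by move=> nu t _ _; rewrite lee_fin sqmaj_term_ge0.
by move=> nu _; apply/measurable_EFinP; exact: tmeas_sqmaj_term.
Qed.

Lemma tint_sqr nu : tint (fun x => h nu x ^+ 2).
Proof.
under eq_fun do rewrite expr2.
by apply: tint_fbounded; [exact: tmeasM|exact: fboundedM].
Qed.

Lemma integrable_sqmaj : mu.-integrable setT (fun t => sqmaj (tvec t)).
Proof.
apply/integrableP; split; first exact: measurable_sqmaj.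
under eq_integral do rewrite gee0_abs ?sqmaj_ge0//.
rewrite /sqmaj integral_nneseries//; last 2 first.
- by move=> nu; apply/measurable_EFinP; exact: tmeas_sqmaj_term.
- by move=> nu t _; rewrite lee_fin sqmaj_term_ge0.
rewrite (eq_eseriesr (g := fun nu => (s ^- nu * torus_integral (fun x => h nu x ^+ 2))%:E)); last first.
  move=> nu _; rewrite -torus_integralZ; last exact: tint_sqr.
  rewrite /torus_integral /Rintegral fineK//; apply: integrable_fin_num => //.
  exact: (@tintZ _ _ (s ^- nu) _ (tint_sqr nu)).
apply: is_cvg_nneseries_real.
  move=> nu; rewrite mulr_ge0 ?invr_ge0 ?exprn_ge0 ?(ltW s0)//.
  by apply: Rintegral_ge0 => t _; exact: sqr_ge0.
apply: (@is_cvg_geometric_dom _ _ C s); last by rewrite (ltW s0).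
move=> nu; rewrite mulr_ge0 ?invr_ge0 ?exprn_ge0 ?(ltW s0)//=; last first.
  by apply: Rintegral_ge0 => t _; exact: sqr_ge0.
rewrite ler_pdivrMl ?exprn_gt0//; apply: le_trans (hC nu) _.
by rewrite expr2 mulrCA.
Qed.

Definition sqmajr (x : 'rV[R]_n) : R := fine (sqmaj x).

Lemma tint_sqmajr : tint sqmajr.
Proof.
apply: le_integrable integrable_sqmaj => //.
  by apply/measurable_EFinP; apply: measurableT_comp measurable_sqmaj => //; exact: measurable_fine.
move=> t _; rewrite /sqmajr; have := sqmaj_ge0 (tvec t).
by case: (sqmaj (tvec t)) => [r|_|] //=; rewrite ?normr0 ?leey.
Qed.

Lemma sum_le_sqmajr x N : (sqmaj x < +oo)%E ->
  (\sum_(0 <= nu < N) `|h nu x|) ^+ 2 <= (1 - s)^-1 * sqmajr x.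
Proof.
move=> fx.
apply: (@le_trans _ _ ((\sum_(0 <= nu < N) s ^+ nu) * \sum_(0 <= nu < N) s ^- nu * h nu x ^+ 2)).
  apply: cauchy_schwarz_seq => nu _; split; first by rewrite exprn_ge0// ltW.
  split; first exact: sqmaj_term_ge0.
  by rewrite mulrA mulfV ?mul1r ?real_normK ?num_real// expf_neq0// gt_eqF.
apply: ler_pM.
- by apply: sumr_ge0 => nu _; rewrite exprn_ge0// ltW.
- by apply: sumr_ge0 => nu _; exact: sqmaj_term_ge0.
- by apply: geometric_sum_le; rewrite s0.
- rewrite -lee_fin /sqmajr fineK ?ge0_fin_numE ?sqmaj_ge0// -sumEFin.
  by apply: nneseries_lim_ge => nu _ _; rewrite lee_fin sqmaj_term_ge0.
Qed.

Lemma is_cvg_h x : (sqmaj x < +oo)%E -> cvgn (series (h ^~ x)).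
Proof.
move=> fx; apply: normed_cvg; apply: nondecreasing_is_cvgn.
  by apply: nondecreasing_series => nu _ _ /=.
exists (1 + (1 - s)^-1 * sqmajr x) => _ [N _ <-].
have := sum_le_sqmajr N fx; rewrite /series/=.
set y := \sum_(_ <= _ < _) _ => hy.
change (y <= 1 + (1 - s)^-1 * sqmajr x).
(* y <= 1 + y^2 trades the bound on the square for a bound on y. *)
have := sqr_ge0 (y - 1); have := sqr_ge0 y; rewrite sqrrB1 mulr2n; lra.
Qed.

(** The factor cuts the series off where the majorant is infinite: the limit then exists at
every point, so that measurability and periodicity hold everywhere. *)
Definition sqsum (x : 'rV[R]_n) : R :=
  limn (fun N => series (h ^~ x) N * ((sqmaj x < +oo)%E%:R : R)).

Lemma sqsumE x : (sqmaj x < +oo)%E -> series (h ^~ x) @ \oo --> sqsum x.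
Proof.
move=> fx; rewrite /sqsum fx; under [X in limn X]eq_fun do rewrite mulr1.
exact: is_cvg_h.
Qed.

Lemma tmeas_sqsum : tmeas sqsum.
Proof.
apply: (measurable_fun_cvg (h := fun N t =>
   series (h ^~ (tvec t)) N * ((sqmaj (tvec t) < +oo)%E%:R : R))).
  move=> N; apply: measurable_funM.
    exact: (@tmeas_sum _ (index_iota 0 N) h hm).
  rewrite (_ : (fun t => _) = \1_(setT `&` [set t | (sqmaj (tvec t) < +oo)%E])).
    apply: measurable_indic; apply: emeasurable_fun_infty_o => //.
    exact: measurable_sqmaj.
  by apply/funext => t; rewrite setTI indicE; congr (nat_of_bool _)%:R;
    apply/idP/idP => [H|/set_mem//]; exact: mem_set.
move=> t _; rewrite /sqsum; have [fx|fx] := boolP (sqmaj (tvec t) < +oo)%E.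
  by apply: is_cvgM; [exact: is_cvg_h|exact: is_cvg_cst].
have -> : (fun N : nat => series (h ^~ (tvec t)) N * (false%:R : R)) = (fun=> 0).
  by apply/funext => N; rewrite mulr0.
exact: is_cvg_cst.
Qed.

Lemma periodic_sqsum : torus_periodic sqsum.
Proof.
move=> k x; rewrite /sqsum /sqmaj.
have E : (fun nu => h nu (x + (2 * pi) *: map_mx intr k)) = h ^~ x.
  by apply/funext => nu; rewrite hp.
rewrite E; congr (limn _); apply/funext => N; congr (_ * (nat_of_bool (_ < _)%E)%:R).
by apply: eq_eseriesr => nu _; rewrite hp.
Qed.

Lemma sqsum_sqr_le x : sqsum x ^+ 2 <= (1 - s)^-1 * sqmajr x.
Proof.
have i0 : 0 <= (1 - s)^-1 by rewrite invr_ge0 subr_ge0 ltW.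
have [fx|fx] := boolP (sqmaj x < +oo)%E; last first.
  rewrite /sqsum (negbTE fx).
  have -> : (fun N : nat => series (h ^~ x) N * (false%:R : R)) = (fun=> 0).
    by apply/funext => N; rewrite mulr0.
  by rewrite lim_cst// expr0n mulr_ge0// fine_ge0 ?sqmaj_ge0.
have c2 : (fun N => series (h ^~ x) N ^+ 2) @ \oo --> sqsum x ^+ 2.
  by under eq_cvg do rewrite expr2; rewrite expr2; apply: cvgM; exact: sqsumE.
rewrite -(cvg_lim _ c2)//; apply: limr_le; first by apply/cvg_ex; eexists; exact: c2.
apply: nearW => N; apply: le_trans (sum_le_sqmajr N fx).
rewrite /series/= -(real_normK (num_real (\sum_(_ <= _ < _) _))).
by apply: lerXn2r; rewrite ?nnegrE ?sumr_ge0//; exact: ler_norm_sum.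
Qed.

Lemma tint_sqsum_sqr : tint (fun x => sqsum x ^+ 2).
Proof.
apply: (@le_tint _ _ _ (fun x => (1 - s)^-1 * sqmajr x)).
- by under eq_fun do rewrite expr2; apply: tmeasM; exact: tmeas_sqsum.
- by apply: tintZ; exact: tint_sqmajr.
- move=> x; rewrite ger0_norm ?sqr_ge0// (le_trans (sqsum_sqr_le x))//.
  exact: ler_norm.
Qed.

Lemma ae_sqmaj : {ae mu, forall t, (sqmaj (tvec t) < +oo)%E}.
Proof.
have := integrable_ae measurableT integrable_sqmaj.
apply: torus_aeS => t /(_ I).
by rewrite ge0_fin_numE// sqmaj_ge0.
Qed.

Lemma cvg_torus_integral_sqsum (phi : 'rV[R]_n -> R) : tmeas phi -> fbounded phi ->
  series (fun nu => torus_integral (fun x => h nu x * phi x)) @ \oo -->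
  torus_integral (fun x => sqsum x * phi x).
Proof.
move=> mp [M bp]; have bphi : fbounded phi by exists M.
have M0 : 0 <= M by exact: le_trans (normr_ge0 _) (bp 0).
have [] := @torus_integral_dominated _ n (fun N x => series (h ^~ x) N * phi x)
   (fun x => sqsum x * phi x) (fun x => M * (1 + (1 - s)^-1 * sqmajr x)).
- by move=> N; apply: tmeasM => //; exact: (@tmeas_sum _ (index_iota 0 N) h hm).
- by apply: tmeasM => //; exact: tmeas_sqsum.
- apply: tintZ; apply: tintD; first exact: tint_cst.
  by apply: tintZ; exact: tint_sqmajr.
- apply: torus_aeS ae_sqmaj => t fx.
  by apply: cvgM; [exact: sqsumE|exact: cvg_cst].
- apply: torus_aeS ae_sqmaj => t fx N.
  rewrite normrM mulrC ler_pM//.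
  have := sum_le_sqmajr N fx.
  set y := \sum_(_ <= _ < _) _ => hy.
  apply: (@le_trans _ _ y); first exact: ler_norm_sum.
  have := sqr_ge0 (y - 1); have := sqr_ge0 y; rewrite sqrrB1 mulr2n; lra.
move=> _; rewrite (_ : (fun N => torus_integral _) = series (fun nu =>
    torus_integral (fun x => h nu x * phi x)))//.
apply/funext => N; rewrite /series/= -torus_integral_sum => [|nu].
  by congr torus_integral; apply/funext => x; rewrite mulr_suml.
by apply: tintM => //; exact: tint_fbounded.
Qed.

End L2_series.

(** * Weak derivatives of the power-law field *)
Section existence.
Context {R : realType} {n : nat} (i0 : 'I_n).
Variables (b : nat) (p : R).
Hypothesis b1 : (1 < b)%N.
Hypothesis np : n%:R < p.

Let mS nu (k : 'rV[int]_n) : (k \in shell_seq b nu) = (level b k == nu).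
Proof. exact: mem_shell_seq. Qed.

(** Parseval for one level.  Only the even part of a and the odd part of c survive, and the
level is symmetric under k -> - k, hence the symmetry asked of w. *)
Lemma torus_integral_block_sqr (a c : 'rV[int]_n -> R) (w : 'rV[int]_n -> R) nu :
  (forall k, a k ^+ 2 <= w k) -> (forall k, c k ^+ 2 <= w k) ->
  (forall k, w (- k) = w k) ->
  torus_integral (fun x => block (@shell_seq n b) a c nu x ^+ 2) <=
  2 * \sum_(k <- @shell_seq n b nu) w k.
Proof.
move=> aw cw wN.
set B := block _ a c nu.
have -> : (fun x => B x ^+ 2) = (fun x => B x * B x).
  by apply/funext => x; rewrite expr2.
have mB : tmeas B by exact: tmeas_block.
have bB : fbounded B by exact: fbounded_block.
rewrite {1}/B torus_integral_blockM// mulr_sumr big_seq [leRHS]big_seq.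
apply: ler_sum => k; rewrite mS => /eqP kl.
have kN : level b (- k) = nu by rewrite levelN.
have -> : torus_integral (fun x => cosp k x * B x) = 2^-1 * (a (- k) + a k).
  have -> : (fun x => cosp k x * B x) = (fun x => B x * cosp k x).
    by apply/funext => x; rewrite mulrC.
  rewrite torus_integral_blockM; [|exact: tmeas_cosp|exact: fbounded_cosp].
  under eq_bigr do rewrite torus_integral_cosp2 torus_integral_sinp_cosp mulr0 addr0 mulrCA mulrDr.
  rewrite -mulr_sumr big_split/= !(sum_level mS (@shell_seq_uniq n b)) kN kl eqxx.
  by rewrite !mul1r.
have -> : torus_integral (fun x => sinp k x * B x) = 2^-1 * (c k - c (- k)).
  have -> : (fun x => sinp k x * B x) = (fun x => B x * sinp k x).
    by apply/funext => x; rewrite mulrC.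
  rewrite torus_integral_blockM; [|exact: tmeas_sinp|exact: fbounded_sinp].
  have E l : torus_integral (fun x : 'rV[R]_n => cosp l x * sinp k x) = 0.
    rewrite -[RHS](torus_integral_sinp_cosp k l).
    by congr torus_integral; apply/funext => x; exact: mulrC.
  under eq_bigr do rewrite E torus_integral_sinp2 mulr0 add0r mulrCA mulrBr.
  rewrite -mulr_sumr sumrB !(sum_level mS (@shell_seq_uniq n b)) kN kl eqxx.
  by rewrite !mul1r.
have := aw k; have := aw (- k); have := cw k; have := cw (- k); rewrite wN.
have := sqr_ge0 (a k - a (- k)); have := sqr_ge0 (c k + c (- k)).
nra.
Qed.

Lemma dcoefl_le c (s : seq 'I_n) (v : 'rV[int]_n -> R) k :
  `|c.1 k| <= v k -> `|c.2 k| <= v k ->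
  `|(dcoefl c s).1 k| <= (l1norm k)%:R ^+ size s * v k /\
  `|(dcoefl c s).2 k| <= (l1norm k)%:R ^+ size s * v k.
Proof.
elim: s c v => [|i s IH] c v h1 h2 /=; first by rewrite expr0 mul1r.
rewrite exprSr -mulrA.
apply: (IH (dcoef i c) (fun k => (l1norm k)%:R * v k)); rewrite /= normrM ?normrN.
  by apply: ler_pM => //; exact: le_coord_l1norm.
by apply: ler_pM => //; exact: le_coord_l1norm.
Qed.

(** Differentiating a level multiplies its coefficients by at most |k|^m, so by Parseval its
derivative has squared norm at most the shell sum of |k|^(2m - 2p), which decays
geometrically when 2 m + n < 2 p.  The series of the derivatives therefore converges in
the mean, and the identity defining the weak derivative passes to the limit from the
levels, where it is an integration by parts. *)
Lemma power_weak_partial (s : seq 'I_n) :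
  2 * (size s)%:R + n%:R < 2 * p ->
  exists g, is_weak_partial s (@power_field R n i0 b p) g.
Proof.
set m := size s => mp.
pose c : ('rV[int]_n -> R) * ('rV[int]_n -> R) := dcoefl (ampl p, sampl i0 p) s.
pose h nu := block (@shell_seq n b) c.1 c.2 nu.
pose e := 2 * p - 2 * m%:R - n%:R.
have e0 : 0 < e by rewrite /e; lra.
pose r := b%:R `^ (- e) : R.
have b0 : (0 : R) < b%:R by rewrite ltr0n; lia.
have /andP[_ r1] : 0 <= r < 1 by exact: powR_baseN_lt1.
have r0 : 0 < r by exact: powR_gt0.
pose C1 := (3 * b%:R) ^+ n * b%:R `^ e : R.
have C10 : 0 <= C1 by rewrite mulr_ge0 ?exprn_ge0 ?powR_ge0 ?mulr_ge0 ?ler0n.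
pose v (k : 'rV[int]_n) : R := (l1norm k)%:R ^+ m * ampl p k.
have v0 k : 0 <= v k by rewrite mulr_ge0 ?exprn_ge0 ?ampl_ge0.
have hc nu : torus_integral (fun x => h nu x ^+ 2) <=
   2 * \sum_(k <- @shell_seq n b nu) v k ^+ 2.
  have cv k : `|c.1 k| <= v k /\ `|c.2 k| <= v k.
    by apply: dcoefl_le => /=; [rewrite ger0_norm ?ampl_ge0|exact: sampl_le].
  apply: torus_integral_block_sqr => k.
  - by rewrite -(real_normK (num_real _)) lerXn2r ?nnegrE// (cv k).1.
  - by rewrite -(real_normK (num_real _)) lerXn2r ?nnegrE// (cv k).2.
  - by rewrite /v amplN l1normN.
have p0 : p != 0 by rewrite gt_eqF// (le_lt_trans _ np).
have hC nu : torus_integral (fun x => h nu x ^+ 2) <= (2 * C1 / r) * (Num.sqrt r ^+ nu) ^+ 2.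
  rewrite -exprM mulnC exprM (sqr_sqrtr (ltW r0)).
  apply: le_trans (hc nu) _; case: nu => [|nu].
    rewrite big1_seq => [|k /andP[_]].
      by rewrite mulr0 !mulr_ge0 ?invr_ge0 ?exprn_ge0 ?(ltW r0).
    rewrite mS /level; case: (eqVneq k 0) => // -> _.
    by rewrite /v /ampl l1norm0 powR0 ?oppr_eq0// mulr0 expr0n.
  rewrite exprS mulrA mulfVK ?gt_eqF// -mulrA ler_wpM2l//.
  have := @shell_decay R n b b1 e nu (ltW e0); apply: le_trans.
  rewrite big_seq [leRHS]big_seq; apply: ler_sum => k; rewrite mS => /eqP kl.
  have kp : (0 : R) < (l1norm k)%:R by rewrite ltr0n l1norm_ge1// (level_gt0 kl).
  rewrite /v /ampl -(powR_mulrn m (ltW kp)) -powRD ?(gt_eqF kp) ?implybT//.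
  rewrite -(powR_mulrn 2 (powR_ge0 _ _)) -powRrM.
  by rewrite le_eqVlt; apply/orP; left; apply/eqP; congr (_ `^ _); rewrite /e; ring.
have s01 : 0 < Num.sqrt r < 1.
  by rewrite sqrtr_gt0 r0/= -[ltRHS]sqrtr1 ltr_sqrt.
have hm nu : tmeas (h nu) by exact: tmeas_block.
have hb nu : fbounded (h nu) by exact: fbounded_block.
have hp nu : torus_periodic (h nu) by exact: periodic_block.
pose g := sqsum h (Num.sqrt r).
exists (fun x => \row_j g x); split.
  split=> [k x|j]; first by apply/rowP => j; rewrite !mxE /g periodic_sqsum.
  under eq_fun do rewrite mxE.
  apply: (@Lfun2_tint R n g); first exact: (tmeas_sqsum s01 hm).
  exact: (tint_sqsum_sqr s01 hm hb hC).
move=> phi j sphi.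
have phi_m : tmeas phi /\ fbounded phi.
  have [pp /(_ [::] isT)[/= cp _]] := sphi 0%N.
  by split; [exact: tmeas_continuous|exact: fbounded_periodic].
have psi_m : tmeas (partials s phi) /\ fbounded (partials s phi).
  have [pp /(_ s (leqnn _))[/= cp _]] := sphi m.
  split; [exact: tmeas_continuous|apply: fbounded_periodic => //].
  exact: torus_periodic_partials.
have -> : (fun x => power_field i0 b p x 0 j * partials s phi x) =
    (fun x => power_wave i0 b p x * partials s phi x).
  by apply/funext => x; rewrite mxE.
have -> : (fun x => (\row_j g x : 'rV[R]_n) 0 j * phi x) = (fun x => g x * phi x).
  by apply/funext => x; rewrite mxE.
have c1 := cvg_torus_integral_wave_series (@wave_summable_power R n i0 b p b1 np) psi_m.1 psi_m.2.
have c2 : series (fun nu => torus_integral (fun x =>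
    block (@shell_seq n b) (ampl p) (sampl i0 p) nu x * partials s phi x)) @ \oo -->
    (-1) ^+ m * torus_integral (fun x => g x * phi x).
  rewrite (_ : series _ = fun N => (-1) ^+ m *
     series (fun nu => torus_integral (fun x => h nu x * phi x)) N); last first.
    apply/funext => N; rewrite /series/= mulr_sumr; apply: eq_bigr => nu _.
    by rewrite -(@torus_integral_partials _ _ _ (ampl p, sampl i0 p) s phi sphi).
  apply: cvgM; first exact: cvg_cst.
  exact: (cvg_torus_integral_sqsum s01 hm hb hC phi_m.1 phi_m.2).
exact: (cvg_unique _ c1 c2).
Qed.

End existence.

(** * What boundedness and square integrability say of cosine coefficients *)
Section coefficient_bounds.
Context {R : realType} {n : nat}.
Implicit Types (g : 'rV[R]_n -> R).

Lemma torus_Lp2_tint (g : 'rV[R]_n -> 'rV[R]_n) j : torus_Lp 2%:E g ->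
  tint (fun x => g x 0 j) /\ tint (fun x => g x 0 j ^+ 2).
Proof.
move=> [_ /(_ j) gj]; split; last exact: Lfun2_integrable_sqr.
apply/Lfun1_integrable; apply: Lfun_subset12 gj.
by rewrite fin_num_measure.
Qed.

Lemma ae_torus_integral_ge0 g : tint g ->
  {ae torus_measure R n, forall t, 0 <= g (tvec t)} -> 0 <= torus_integral g.
Proof.
move=> ig g0; have mg := tint_tmeas ig.
rewrite /torus_integral /Rintegral.
rewrite (ae_eq_integral (fun t => (Num.max (g (tvec t)) 0)%:E))//=.
- by apply: fine_ge0; apply: integral_ge0 => t _; rewrite lee_fin le_max lexx orbT.
- exact/measurable_EFinP.
- by apply/measurable_EFinP; apply: measurable_maxr.
- by apply: torus_aeS g0 => t g0 _; congr _%:E; rewrite max_l.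
Qed.

Lemma box_add_sub N (k l : 'rV[int]_n) : k \in box N -> l \in box N ->
  k + l \in box N.*2.
Proof.
rewrite !mem_box => /forallP hk /forallP hl; apply/forallP => j.
have := hk j; have := hl j; rewrite mxE -addnn.
by move: (k 0 j) (l 0 j) => a b *; lia.
Qed.

Lemma size_box_double N : (size (@box n N.*2) <= 2 ^ n * size (@box n N))%N.
Proof.
rewrite !size_box -expnMn; case: (posnP n) => [->//|n0].
by rewrite leq_exp2r// -!mul2n; lia.
Qed.

(** Integrate g against the kernel sum_(k,l) cos<k - l,x>, k and l in the box of size 2N.
The kernel is |sum_k exp(i<k,x>)|^2 >= 0 and has mean the number of points of that box,
so the integral is at most M times this number.  It also equals sum_(k,l) a(k - l), in
which every d of the box of size N occurs as a difference at least as many times as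
that box has points.  The two boxes differ in size by a factor at most 2^n. *)
Lemma sum_bounded_coef g (a : 'rV[int]_n -> R) (P : pred 'rV[int]_n) M N :
  tint g -> {ae torus_measure R n, forall t, g (tvec t) <= M} -> 0 <= M ->
  (forall l, torus_integral (fun x => g x * cosp l x) = a l) ->
  (forall l, 0 <= a l) ->
  \sum_(d <- box N | P d) a d <= 2 ^+ n * M.
Proof.
move=> ig gM M0 ga a0.
pose D := @box n N.*2.
pose F (x : 'rV[R]_n) : R := \sum_(k <- D) \sum_(l <- D) cosp (k - l) x.
have FE x : F x = (\sum_(k <- D) cosp k x) ^+ 2 + (\sum_(k <- D) sinp k x) ^+ 2.
  rewrite !expr2 !mulr_suml -big_split/=; apply: eq_bigr => k _.
  rewrite !mulr_sumr -big_split/=; apply: eq_bigr => l _.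
  by rewrite cosp_cosp sinp_sinp; field.
have iF : tint F by do 2 apply: tint_sum => ?; exact: tint_cosp.
have bF : fbounded F.
  exists (\sum_(k <- D) \sum_(l <- D) 1) => x.
  by do 2 (apply: (le_trans (ler_norm_sum _ _ _)); apply: ler_sum => ? _); exact: cosp_le1.
have IF : torus_integral F = (size D)%:R.
  rewrite torus_integral_sum; last by move=> k; apply: tint_sum => l; exact: tint_cosp.
  rewrite -sum1_size natr_sum big_seq [RHS]big_seq; apply: eq_bigr => k kD.
  rewrite torus_integral_sum; last by move=> l; exact: tint_cosp.
  rewrite (bigD1_seq k)//= ?box_uniq// subrr torus_integral_cosp eqxx big1 ?addr0//.
  by move=> l lk; rewrite torus_integral_cosp subr_eq0 eq_sym (negbTE lk).
have igF : tint (fun x => g x * F x) by apply: tintM => //; exact: tint_tmeas.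
have IgF : torus_integral (fun x => g x * F x) = \sum_(k <- D) \sum_(l <- D) a (k - l).
  under eq_fun do rewrite mulr_sumr.
  rewrite torus_integral_sum; last first.
    move=> k; under eq_fun do rewrite mulr_sumr.
    by apply: tint_sum => l; apply: tintM => //; [exact: tmeas_cosp|exact: fbounded_cosp].
  apply: eq_bigr => k _; under eq_fun do rewrite mulr_sumr.
  rewrite torus_integral_sum => [|l]; first by apply: eq_bigr => l _; rewrite ga.
  by apply: tintM => //; [exact: tmeas_cosp|exact: fbounded_cosp].
have up : \sum_(k <- D) \sum_(l <- D) a (k - l) <= M * (size D)%:R.
  rewrite -IF -IgF -torus_integralZ// -subr_ge0 -torus_integralB//; last exact: tintZ.
  apply: ae_torus_integral_ge0; first by apply: tintB => //; exact: tintZ.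
  apply: torus_aeS gM => t gM; rewrite -mulrBl mulr_ge0 ?subr_ge0//.
  by rewrite FE addr_ge0 ?sqr_ge0.
set s := \sum_(d <- _ | _) _.
have sN (l : 'rV[int]_n) : l \in box N -> s <= \sum_(k <- D) a (k - l).
  move=> lN; apply: (@le_trans _ _ (\sum_(d <- box N) a d)).
    by rewrite [leRHS](bigID P)/= lerDl sumr_ge0.
  rewrite (_ : \sum_(d <- box N) a d = \sum_(k <- [seq d + l | d <- box N]) a (k - l)).
    apply: (@sumr_le_subseq R _ _ _ predT) => [||k|k]; last exact: a0.
    - by rewrite map_inj_uniq ?box_uniq//; exact: addIr.
    - exact: box_uniq.
    - by move=> /mapP[d dN ->]; split => //; exact: box_add_sub.
  by rewrite [RHS]big_map; apply: eq_bigr => d _; rewrite addrK.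
have low : (size (@box n N))%:R * s <= \sum_(k <- D) \sum_(l <- D) a (k - l).
  rewrite exchange_big/=.
  apply: (@le_trans _ _ (\sum_(l <- box N) \sum_(k <- D) a (k - l))).
    rewrite -sum1_size natr_sum mulr_suml big_seq [leRHS]big_seq.
    by apply: ler_sum => l lN; rewrite mul1r; exact: sN.
  apply: (@sumr_le_subseq R _ _ _ predT) => [||l lN|l]; rewrite ?box_uniq//.
    split => //; rewrite -[l]addr0; apply: box_add_sub => //.
    by rewrite mem_box; apply/forallP => j; rewrite mxE.
  by apply: sumr_ge0.
have N0 : (0 : R) < (size (@box n N))%:R by rewrite ltr0n size_box expn_gt0.
rewrite -(ler_pM2l N0); apply: le_trans low _; apply: le_trans up _.
rewrite mulrA [leRHS]mulrC ler_wpM2l// -natrX -natrM ler_nat mulnC.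
exact: size_box_double.
Qed.

(** Expand the square of g - sum_d a_d cos<d,x>.  The cosines for d and - d coincide, so the
mean square of the sum may be twice what it is for unrelated frequencies, (1/2) sum a_d^2;
it is still at most sum a_d^2. *)
Lemma bessel_cosp g (a : 'rV[int]_n -> R) (D : seq 'rV[int]_n) :
  uniq D -> tint g -> tint (fun x => g x ^+ 2) ->
  (forall l, torus_integral (fun x => g x * cosp l x) = a l) ->
  \sum_(d <- D) a d ^+ 2 <= torus_integral (fun x => g x ^+ 2).
Proof.
move=> uD ig ig2 ga.
have aN l : a (- l) = a l.
  by rewrite -!ga; congr torus_integral; apply/funext => x; rewrite /cosp pairingNl cosN.
pose F (x : 'rV[R]_n) : R := \sum_(d <- D) a d * cosp d x.
have mcos l : tmeas (@cosp R n l) by exact: tmeas_cosp.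
have bcos l : fbounded (@cosp R n l) by exact: fbounded_cosp.
have iF : tint F by apply: tint_sum => d; apply: tintZ; exact: tint_cosp.
have mF := tint_tmeas iF.
have bF : fbounded F.
  exists (\sum_(k <- D) `|a k|) => x.
  apply: (le_trans (ler_norm_sum _ _ _)); apply: ler_sum => k _.
  by rewrite normrM ler_piMr// cosp_le1.
have igF : tint (fun x => g x * F x) by exact: tintM.
have iFF : tint (fun x => F x * F x) by exact: tintM.
have IgF : torus_integral (fun x => g x * F x) = \sum_(d <- D) a d ^+ 2.
  under eq_fun do rewrite mulr_sumr.
  under eq_fun do under eq_bigr do rewrite mulrCA.
  rewrite torus_integral_sum => [|d]; last by apply: tintZ; exact: tintM.
  by apply: eq_bigr => d _; rewrite torus_integralZ ?ga ?expr2//; exact: tintM.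
have IFF : torus_integral (fun x => F x * F x) <= \sum_(d <- D) a d ^+ 2.
  under eq_fun do rewrite {1}/F mulr_suml.
  under eq_fun do under eq_bigr do rewrite -mulrA.
  rewrite torus_integral_sum => [|d]; last first.
    by apply: tintZ; apply: tintM => //; exact: tint_cosp.
  apply: ler_sum => d _; rewrite torus_integralZ; last first.
    by apply: tintM => //; exact: tint_cosp.
  under eq_fun do rewrite mulr_sumr.
  under eq_fun do under eq_bigr do rewrite mulrCA.
  rewrite torus_integral_sum => [|e]; last first.
    by apply: tintZ; apply: tintM => //; exact: tint_cosp.
  rewrite mulr_sumr.
  have count1 c : \sum_(e <- D) ((e == c)%:R : R) <= 1.
    rewrite -natr_sum -big_mkcond/= sum1_count -[1]/(1%:R) ler_nat.
    by rewrite count_uniq_mem// leq_b1.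
  apply: (@le_trans _ _ (\sum_(e <- D) a d ^+ 2 * (2^-1 * ((e == - d)%:R + (e == d)%:R)))).
    apply: ler_sum => e _; rewrite torus_integralZ; last first.
      by apply: tintM => //; exact: tint_cosp.
    rewrite torus_integral_cosp2 [_ == - e]eq_sym eqr_oppLR [d == e]eq_sym.
    have [->|_] := eqVneq e (- d); first by rewrite aN mulrA -expr2.
    by have [->|_] := eqVneq e d; rewrite ?mulrA -?expr2// addr0 !mulr0.
  rewrite -mulr_sumr -[leRHS]mulr1 ler_wpM2l ?sqr_ge0//.
  rewrite -mulr_sumr big_split/=; have := count1 d; have := count1 (- d); lra.
have ige : tint (fun x => 2 * (g x * F x)) by exact: tintZ.
have : 0 <= torus_integral (fun x => g x ^+ 2 - 2 * (g x * F x) + F x * F x).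
  apply: Rintegral_ge0 => t _.
  by rewrite (_ : _ + _ = (g (tvec t) - F (tvec t)) ^+ 2) ?sqr_ge0//; ring.
rewrite torus_integralD//; last exact: tintB.
rewrite torus_integralB// torus_integralZ// IgF; lra.
Qed.

End coefficient_bounds.

(** * Failure of boundedness and of square integrability *)
Section unbounded.
Context {R : realType} {n : nat} (i0 : 'I_n).
Variables (b : nat) (p : R).
Hypothesis b1 : (1 < b)%N.
Hypothesis np : n%:R < p.

(** The common absolute value of the cosine coefficients of the derivative of order m of the
power-law field in direction i0. *)
Definition dampl (m : nat) (l : 'rV[int]_n) : R :=
  `|(l 0 i0)%:~R| ^+ m * ampl p l.

Lemma dampl_ge0 m l : 0 <= dampl m l.
Proof. by rewrite mulr_ge0 ?exprn_ge0 ?ampl_ge0. Qed.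

(** Iterated derivatives of cos in one direction alternate between sines and cosines. *)
Lemma dcoefs_nseq m : exists e : R, e ^+ 2 = 1 /\
  dcoefs (nseq m i0) (fun=> 1, fun=> 0) =
  if odd m then (fun=> 0, fun k : 'rV[int]_n => e * (k 0 i0)%:~R ^+ m)
  else (fun k : 'rV[int]_n => e * (k 0 i0)%:~R ^+ m, fun=> 0).
Proof.
elim: m => [|m [e [e2 IH]]].
  exists 1; rewrite expr1n; split => //=; congr (_, _).
  by apply/funext => k; rewrite mulr1.
rewrite /= IH; case: (odd m) => /=.
  exists e; split => //; rewrite /dcoef; congr (_, _); apply/funext => k /=.
    by rewrite exprS mulrCA.
  by rewrite mulr0.
exists (- e); split; first by rewrite sqrrN.
rewrite /dcoef; congr (_, _); apply/funext => k /=; first by rewrite mulr0.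
by rewrite exprS; ring.
Qed.

Lemma exprn_sgr_odd m (x : R) : x ^+ m * Num.sg x ^+ odd m = `|x| ^+ m.
Proof.
have [->|x0] := eqVneq x 0; last by rewrite -normrX normrEsg sgrX (sgr_odd m)// mulrC.
by case: m => [|m]; rewrite normr0 !expr0n/= ?mul1r ?mul0r.
Qed.

(** Test the weak derivative against cos<l,x>.  Its derivative of order m is a cosine or a
sine according to the parity of m, and the field pairs with either to give
|l_i0|^m |l|^-p, the sign carried by the sine coefficients absorbing that of l_i0^m. *)
Lemma weak_partial_cosp m g : is_weak_partial (nseq m i0) (@power_field R n i0 b p) g ->
  exists e : R, e ^+ 2 = 1 /\ forall j l,
    torus_integral (fun x => e * g x 0 j * cosp l x) = dampl m l.
Proof.
move=> [g2 gw]; have [e [e2 dE]] := dcoefs_nseq m.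
exists ((-1) ^+ m * e); split; first by rewrite exprMn e2 mulr1 sqrr_sign.
move=> j l.
pose c : ('rV[int]_n -> R) * ('rV[int]_n -> R) := (fun=> 1, fun=> 0).
have cE : cosp l = trigsum [:: l] c.
  by apply/funext => x; rewrite /trigsum big_seq1 /= mul1r mul0r addr0.
have [gi _] := torus_Lp2_tint j g2.
have icos : tint (fun x => g x 0 j * cosp l x).
  by apply: tintM => //; [exact: tmeas_cosp|exact: fbounded_cosp].
under eq_fun do rewrite -mulrA.
rewrite torus_integralZ//.
have := gw (cosp l) j; rewrite {1}cE => /(_ (torus_Cinfty_trigsum _ _)).
rewrite size_nseq [in X in X = _]cE partials_trigsum dE => gE.
have mcos : tmeas (@cosp R n l) by exact: tmeas_cosp.
have msin : tmeas (@sinp R n l) by exact: tmeas_sinp.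
have bcos : fbounded (@cosp R n l) by exact: fbounded_cosp.
have bsin : fbounded (@sinp R n l) by exact: fbounded_sinp.
have iw := @tint_power_wave R n i0 b p b1 np.
have wE d : torus_integral (fun x => power_field i0 b p x 0 j * trigsum [:: l] d x) =
    d.1 l * ampl p l + d.2 l * sampl i0 p l.
  rewrite (_ : (fun x => _) = (fun x => d.1 l * (power_wave i0 b p x * cosp l x) +
       d.2 l * (power_wave i0 b p x * sinp l x))); last first.
    by apply/funext => x; rewrite mxE /trigsum big_seq1; ring.
  rewrite torus_integralD; [|by apply: tintZ; exact: tintM..].
  rewrite !torus_integralZ; [|exact: tintM..].
  by rewrite power_wave_cosp// power_wave_sinp.
rewrite mulrAC -gE wE /dampl -exprn_sgr_odd /sampl.
have ee x : e * x * e = x by rewrite mulrAC -expr2 e2 mul1r.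
by case: (odd m) => /=; rewrite !(mul0r, add0r, addr0) ?mulr1 ?expr1 -[RHS]ee; ring.
Qed.

Lemma dampl_cone m l : cone i0 l ->
  2 ^- m * (l1norm l)%:R `^ (m%:R - p) <= dampl m l.
Proof.
move=> /andP[l0 hl].
have lp : (0 : R) < (l1norm l)%:R by rewrite ltr0n l1norm_ge1.
rewrite powRD ?(gt_eqF lp) ?implybT// powR_mulrn ?(ltW lp)// mulrA.
rewrite ler_wpM2r ?powR_ge0// -exprVn -exprMn; apply: lerXn2r; rewrite ?nnegrE//.
rewrite ler_pdivrMl//; move: hl; rewrite -(ler_int R) intrM => hl.
by apply: le_trans hl _; rewrite ler_pM2l// ler_norm.
Qed.

(** On the cone the coefficients are at least 2^-m |k|^-n when p <= n + m, and the sum of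
|k|^-n over the cone exceeds any bound of the kind given by sum_bounded_coef. *)
Lemma power_partial_unbounded m g M : p <= n%:R + m%:R ->
  is_weak_partial (nseq m i0) (@power_field R n i0 b p) g ->
  ~ {ae torus_measure R n, forall t, `|g (tvec t)| <= M}.
Proof.
move=> pm gw gM; have [e [e2 ge]] := weak_partial_cosp gw.
have [gi _] := torus_Lp2_tint i0 gw.1.
(* K is visibly nonnegative; for M this would depend on the measure not being zero. *)
pose K := `|M| + 1.
have K0 : 0 <= K by rewrite addr_ge0.
have e1 : `|e| = 1 by apply/eqP; rewrite -sqrp_eq1// real_normK ?num_real// e2.
have gM' : {ae torus_measure R n, forall t, e * g (tvec t) 0 i0 <= K}.
  apply: torus_aeS gM => t gM; apply: le_trans (ler_norm _) _.
  rewrite normrM e1 mul1r.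
  apply: (@le_trans _ _ `|g (tvec t)|).
    rewrite [leRHS]/Num.Def.normr/= mx_normrE.
    exact: (le_bigmax _ (fun ij => `|g (tvec t) ij.1 ij.2|) (0, i0)).
  by apply: le_trans gM _; rewrite (le_trans (ler_norm M))// lerDl.
have bd N := @sum_bounded_coef R n _ _ (cone i0) K N (tintZ e gi) gM' K0
   (ge i0) (dampl_ge0 m).
have [N hN] := @harmonic_cone_unbounded R n i0 (2 ^+ m * (2 ^+ n * K + 1)).
have := bd N; rewrite leNgt => /negP; apply.
apply: (@lt_le_trans _ _ (2 ^- m * \sum_(k <- box N | cone i0 k) (l1norm k)%:R ^- n)).
  by rewrite ltr_pdivlMl ?exprn_gt0//; apply: lt_le_trans hN; rewrite ltr_pM2l ?exprn_gt0// ltrDl.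
rewrite mulr_sumr; apply: ler_sum => k ck; apply: le_trans (dampl_cone m ck).
have k1 : (1 : R) <= (l1norm k)%:R by rewrite ler1n l1norm_ge1//; case/andP: ck.
rewrite ler_wpM2l// -powR_mulrn ?ler0n// -powRN ler_powR//; lra.
Qed.

(** The squares of the coefficients are at least 4^-m |k|^-n on the cone when
2 p <= n + 2 m, so their sum diverges, against Bessel's inequality. *)
Lemma power_partial_not_L2 m g : 2 * p <= n%:R + 2 * m%:R ->
  ~ is_weak_partial (nseq m i0) (@power_field R n i0 b p) g.
Proof.
move=> pm gw; have [e [e2 ge]] := weak_partial_cosp gw.
have [gi gi2] := torus_Lp2_tint i0 gw.1.
have gE : (fun x => (e * g x 0 i0) ^+ 2) = (fun x => g x 0 i0 ^+ 2).
  by apply/funext => x; rewrite exprMn e2 mul1r.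
have bd N := @bessel_cosp R n (fun x => e * g x 0 i0) (dampl m) (box N) (box_uniq N) (tintZ e gi).
set K := torus_integral (fun x => g x 0 i0 ^+ 2) in bd.
have [N hN] := @harmonic_cone_unbounded R n i0 (4 ^+ m * (K + 1)).
have := bd N; rewrite gE => /(_ gi2 (ge i0)); rewrite leNgt => /negP; apply.
apply: (@lt_le_trans _ _ (4 ^- m * \sum_(k <- box N | cone i0 k) (l1norm k)%:R ^- n)).
  by rewrite ltr_pdivlMl ?exprn_gt0//; apply: lt_le_trans hN; rewrite ltr_pM2l ?exprn_gt0// ltrDl.
apply: (@le_trans _ _ (\sum_(k <- box N | cone i0 k) dampl m k ^+ 2)); last first.
  by rewrite [leRHS](bigID (cone i0))/= lerDl sumr_ge0// => k _; exact: sqr_ge0.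
rewrite mulr_sumr; apply: ler_sum => k ck.
have k1 : (1 : R) <= (l1norm k)%:R by rewrite ler1n l1norm_ge1//; case/andP: ck.
apply: (@le_trans _ _ ((2 ^- m * (l1norm k)%:R `^ (m%:R - p)) ^+ 2)); last first.
  apply: lerXn2r; rewrite ?nnegrE ?dampl_ge0 ?mulr_ge0 ?powR_ge0//; exact: dampl_cone.
rewrite exprMn (_ : 4 ^- m = (2 ^- m) ^+ 2); last first.
  by rewrite exprVn -exprM mulnC exprM; congr (_ ^+ _)^-1; ring.
rewrite ler_wpM2l ?sqr_ge0//.
rewrite -(powR_mulrn 2 (powR_ge0 _ _)) -powRrM -powR_mulrn ?ler0n// -powRN ler_powR//; lra.
Qed.

End unbounded.

(** * Regularity in the space *)
Theorem theorem1p4 (R : realType) (n b : nat) (tau : R)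
    (hn : (2 <= n)%N) (hb : (2 <= b)%N) (htau : n%:R - 1 <= tau) :
  (forall f : 'rV[R]_n -> 'rV[R]_n, Ltilde tau b f ->
     has_classical_derivatives (Num.truncn (tau - n%:R / 2) + 1) f) /\
  (exists2 f : 'rV[R]_n -> 'rV[R]_n, Ltilde tau b f &
     forall m : nat,
       (Num.truncn (tau - n%:R / 2) + 2 <= m <= Num.truncn tau + 1)%N ->
       admits_weak_derivatives m f /\ ~ ess_bounded (weak_D m f)) /\
  (exists2 f : 'rV[R]_n -> 'rV[R]_n, Ltilde tau b f &
     ~ admits_weak_derivatives (Num.truncn tau + 2) f).
Proof.
have n2 : (2 : R) <= n%:R by rewrite ler_nat.
have tau0 : 0 <= tau by lra.
have tn0 : 0 <= tau - n%:R / 2 by lra.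
pose i0 : 'I_n := Ordinal (ltnW hn).
have lt_trunc (x : R) : x < (Num.truncn x)%:R + 1.
  by rewrite -(natrD _ _ 1) addn1 truncnS_gt.
have tl := lt_trunc (tau - n%:R / 2); have tu := truncn_le tau.
rewrite tau0 in tu.
split; first by move=> f Lf; exact: (Ltilde_classical hb Lf).
split.
  (* The largest exponent for which already the first order [tau - n/2] + 2 is unbounded; it
     still exceeds both tau + 1 + n/2 and m + n/2 for every m <= [tau] + 1. *)
  pose p : R := n%:R + (Num.truncn (tau - n%:R / 2) + 2)%:R.
  have np : n%:R < p by rewrite ltrDl ltr0n addn2.
  have tp : tau + 1 + n%:R / 2 < p.
    by rewrite /p (natrD _ _ 2); lra.
  exists (power_field i0 b p); first exact: Ltilde_power_field.
  move=> m /andP[m1 m2].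
  have mp : 2 * m%:R + n%:R < 2 * p.
    have : m%:R <= tau + 1.
      by rewrite -(ler_nat R) natrD in m2; apply: le_trans m2 _; rewrite lerD2r.
    by lra.
  have wk (s : seq 'I_n) : size s = m -> exists g, is_weak_partial s (power_field i0 b p) g.
    by move=> sm; apply: power_weak_partial => //; rewrite sm.
  split; first exact: wk.
  move=> [M hM]; have [g gw] := wk (nseq m i0) (size_nseq _ _).
  apply: (power_partial_unbounded hb np _ gw (M := M)).
    by rewrite /p lerD2l ler_nat.
  by apply: hM; exists (nseq m i0) => //; exact: size_nseq.
(* The largest exponent for which the order [tau] + 2 fails to be square integrable. *)
pose p : R := (Num.truncn tau + 2)%:R + n%:R / 2.
have tl' := lt_trunc tau.
have np : n%:R < p by rewrite /p (natrD _ _ 2); lra.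
exists (power_field i0 b p); first by apply: Ltilde_power_field => //; rewrite /p (natrD _ _ 2); lra.
move=> /(_ (nseq (Num.truncn tau + 2) i0) (size_nseq _ _)) [g].
by apply: power_partial_not_L2 => //; rewrite /p; lra.
Qed.
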